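(* For every knot $K$, the spherical tiling number and the tiling number satisfy $$st(K) \le t(K) - 1.$$
   Context: A knot means a tame knot: an embedding of $S^1$ into $S^3$ that is ambient isotopic to a polygonal (equivalently smooth) one. A knot diagram represents $K$ if its knot type (ambient isotopy class, unoriented) is that of $K$. Mosaic tiles. The tile set is $\mathcal{T}=\{T_0,\dots,T_{10}\}$; each tile is a unit square with arcs joining midpoints of its sides (sides: left L, right R, top U, bottom D): $T_0$ is empty; $T_1,T_2,T_3,T_4$ contain one arc joining respectively L–D, R–D, R–U, L–U; $T_5$ contains the segment L–R; $T_6$ contains the segment U–D; $T_7$ contains two disjoint arcs L–D and R–U; $T_8$ contains two disjoint arcs R–D and L–U; $T_9$ is a crossing of L–R and U–D with L–R over; $T_{10}$ is a crossing of L–R and U–D with U–D over. Tiles other than $T_0$ are called non-empty. The midpoint of a side of a tile is a connection point if it is an endpoint of an arc on that tile. Classical mosaics. A knot $n$-mosaic ($n\ge 1$) is an $n\times n$ planar grid of tiles from $\mathcal{T}$ such that for any side shared by two adjacent tiles its midpoint is a connection point of one tile iff it is a connection point of the other, there are no connection points on the outer boundary of the grid, and the arcs form a single closed curve (going straight through crossings). It is then a knot diagram. The tiling number $t(K)$ is the minimal number of non-empty tiles in a knot mosaic (of any size $n$) representing $K$. Spherical mosaics. Let the boundary of the cube $[0,n]^3\subset\mathbb{R}^3$ (a topological $S^2$) have each of its six faces divided into an $n\times n$ grid of unit squares. A spherical $n$-mosaic is a placement of one tile of $\mathcal{T}$ (seen from outside the cube) on each of the $6n^2$ unit squares such that, for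 each side shared by two unit squares (including sides lying on edges of the cube), its midpoint is a connection point of one tile iff it is a connection point of the other. It is a spherical knot $n$-mosaic if its arcs form a single closed curve; it is then a knot diagram on $S^2$ and represents a knot. The spherical tiling number $st(K)$ is the smallest integer $t$ such that, for some $n\ge 1$, $K$ is represented by a spherical knot $n$-mosaic with exactly $t$ non-empty tiles. *)

(* Defs.v *)
From HB Require Import structures.
From mathcomp Require Import all_boot all_order all_algebra.
From mathcomp Require Import all_classical all_reals all_analysis.

Set Implicit Arguments.
Unset Strict Implicit.
Unset Printing Implicit Defensive.

Import Order.TTheory GRing.Theory Num.Theory.
Import numFieldNormedType.Exports.

Local Open Scope classical_set_scope.
Local Open Scope ring_scope.

(** * Knots in the 3-sphere *)

Definition circle (R : realType) : set (R * R) :=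
  [set p | p.1 ^+ 2 + p.2 ^+ 2 = 1].

Definition sphere3 (R : realType) : set (R * R * R * R) :=
  [set p | let: (x, y, z, w) := p in x ^+ 2 + y ^+ 2 + z ^+ 2 + w ^+ 2 = 1].

Definition homeomorphism (T U : topologicalType) (A : set T) (B : set U)
    (f : T -> U) : Prop :=
  exists g : U -> T,
    [/\ {within A, continuous f} /\ {within B, continuous g},
        set_fun A B f /\ set_fun B A g,
        forall x, A x -> g (f x) = x
      & forall y, B y -> f (g y) = y].

Definition ambient_isotopic (R : realType) (K L : set (R * R * R * R)) : Prop :=
  exists H : R * (R * R * R * R) -> R * R * R * R,
    [/\ {within `[0, 1]%classic `*` @sphere3 R, continuous H},
        forall t, `[0, 1]%classic t ->
          homeomorphism (@sphere3 R) (@sphere3 R) (fun p => H (t, p)),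
        forall p, sphere3 p -> H (0, p) = p
      & [set H (1, p) | p in K] = L].

(* Knots are unoriented, so that an embedding of the circle is recorded by its
   image. *)
Definition embedded_circle (R : realType) (K : set (R * R * R * R)) : Prop :=
  K `<=` @sphere3 R /\
  exists f : R * R -> R * R * R * R, homeomorphism (@circle R) K f.

(* Inverse stereographic projection: it identifies R^3 with the complement of
   the point (0, 0, 0, 1) of the 3-sphere. *)
Definition to_sphere3 (R : realType) (p : R * R * R) : R * R * R * R :=
  let: (x, y, z) := p in
  let s := x ^+ 2 + y ^+ 2 + z ^+ 2 in
  (2 * x / (s + 1), 2 * y / (s + 1), 2 * z / (s + 1), (s - 1) / (s + 1)).

Definition segment (R : realType) (p q : R * R * R) : set (R * R * R) :=
  [set (1 - t) *: p + t *: q | t in `[0, 1]%classic].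

Definition polygonal (R : realType) (P : set (R * R * R)) : Prop :=
  exists s : seq ((R * R * R) * (R * R * R)),
    P = \bigcup_(e in [set` s]) segment e.1 e.2.

Definition knot (R : realType) (K : set (R * R * R * R)) : Prop :=
  embedded_circle K /\
  exists P : set (R * R * R),
    [/\ polygonal P, embedded_circle (@to_sphere3 R @` P)
      & ambient_isotopic (@to_sphere3 R @` P) K].

(** * Tiles *)

Inductive side := sideL | sideR | sideU | sideD.

Definition side_code (s : side) : bool * bool :=
  match s with
  | sideL => (false, false) | sideR => (false, true)
  | sideU => (true, false) | sideD => (true, true)
  end.
Definition side_decode (c : bool * bool) : side :=
  match c with
  | (false, false) => sideL | (false, true) => sideR
  | (true, false) => sideU | (true, true) => sideD
  end.
Lemma side_codeK : cancel side_code side_decode. Proof. by case. Qed.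
HB.instance Definition _ := Finite.copy side (can_type side_codeK).

Inductive tile := T0 | T1 | T2 | T3 | T4 | T5 | T6 | T7 | T8 | T9 | T10.

Definition nonempty_tile (t : tile) : bool := if t is T0 then false else true.

(* The arcs of a tile, each with its two ends; the flag marks the over-strand
   of a crossing. *)
Definition arcs (t : tile) : seq (side * side * bool) :=
  match t with
  | T0 => [::]
  | T1 => [:: (sideL, sideD, false)]
  | T2 => [:: (sideR, sideD, false)]
  | T3 => [:: (sideR, sideU, false)]
  | T4 => [:: (sideL, sideU, false)]
  | T5 => [:: (sideL, sideR, false)]
  | T6 => [:: (sideU, sideD, false)]
  | T7 => [:: (sideL, sideD, false); (sideR, sideU, false)]
  | T8 => [:: (sideR, sideD, false); (sideL, sideU, false)]
  | T9 => [:: (sideL, sideR, true); (sideU, sideD, false)]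
  | T10 => [:: (sideL, sideR, false); (sideU, sideD, true)]
  end.

Definition joins (a : side * side * bool) (s t : side) : bool :=
  (a.1 == (s, t)) || (a.1 == (t, s)).

Definition connection (t : tile) (s : side) : bool :=
  has (fun a => (a.1.1 == s) || (a.1.2 == s)) (arcs t).

(* Midpoint of a side of the unit square [0, 1]^2, with doubled coordinates. *)
Definition side_mid2 (s : side) : nat * nat :=
  match s with
  | sideL => (0, 1)%N | sideR => (2, 1)%N
  | sideU => (1, 2)%N | sideD => (1, 0)%N
  end.

(** * Mosaics on a surface tiled by unit squares *)

(* [Q] indexes the unit squares, [M] gives the tile on each square and
   [mid q s] is the position of the midpoint of the side [s] of the square [q];
   two squares share a side iff the corresponding midpoints coincide. *)
Definition suitably_connected (Q : finType) (P : eqType) (mid : Q -> side -> P)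
    (M : Q -> tile) : Prop :=
  forall (q r : Q) (s t : side),
    mid q s = mid r t -> connection (M q) s = connection (M r) t.

(* One step along the curve, from an end [(q, s)] of an arc: either to the other
   end of this arc, or across the side [s] to the neighbouring square. *)
Definition curve_step (Q : finType) (P : eqType) (mid : Q -> side -> P)
    (M : Q -> tile) : rel (Q * side) :=
  fun x y =>
    ((x.1 == y.1) && has (fun a => joins a x.2 y.2) (arcs (M x.1)))
    || (mid x.1 x.2 == mid y.1 y.2).

(* In a suitably connected mosaic without boundary connection points every arc
   is continued by exactly one arc at each of its ends, so that the arcs form
   disjoint closed curves; there is a single one iff all arcs can be reached
   from each other. *)
Definition single_curve (Q : finType) (P : eqType) (mid : Q -> side -> P)
    (M : Q -> tile) : Prop :=
  (exists x : Q * side, connection (M x.1) x.2) /\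
  forall x y : Q * side, connection (M x.1) x.2 -> connection (M y.1) y.2 ->
    connect (curve_step mid M) x y.

Definition tile_count (Q : finType) (M : Q -> tile) : nat :=
  #|[pred q | nonempty_tile (M q)]|.

(* A chart [c u v h] gives the point of R^3 at height [h] above the point with
   coordinates [(u, v)] of a unit square [0, 1]^2. An arc is drawn as the
   chord between the midpoints of two sides; the middle of an over-strand is
   raised to height 1/2. *)
Definition arc_lift (R : realType) (c : R -> R -> R -> R * R * R)
    (a : side * side * bool) : set (R * R * R) :=
  let: (s, t, over) := a in
  let: (xs, ys) := side_mid2 s in
  let: (xt, yt) := side_mid2 t in
  let apex := c ((xs + xt)%:R / 4) ((ys + yt)%:R / 4) (if over then 2^-1 else 0)
  in segment (c (xs%:R / 2) (ys%:R / 2) 0) apex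
     `|` segment apex (c (xt%:R / 2) (yt%:R / 2) 0).

Definition mosaic_lift (R : realType) (Q : finType)
    (chart : Q -> R -> R -> R -> R * R * R) (M : Q -> tile) :
    set (R * R * R) :=
  [set p | exists q : Q, exists2 a, a \in arcs (M q) & arc_lift (chart q) a p].

(* A diagram on the plane or on the boundary of a cube represents the knots of
   the type of the curve obtained by pushing its over-strands off the surface,
   on the side from which the diagram is seen. *)
Definition represents (R : realType) (Q : finType)
    (chart : Q -> R -> R -> R -> R * R * R) (M : Q -> tile)
    (K : set (R * R * R * R)) : Prop :=
  ambient_isotopic (@to_sphere3 R @` mosaic_lift chart M) K.

(** * Classical mosaics *)

(* The square [(i, j)] is [i, i + 1] x [j, j + 1], seen from above in R^3. *)
Definition plane_mid2 (n : nat) (q : 'I_n * 'I_n) (s : side) : nat * nat :=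
  (2 * q.1 + (side_mid2 s).1, 2 * q.2 + (side_mid2 s).2)%N.

Definition plane_chart (R : realType) (n : nat) (q : 'I_n * 'I_n)
    (u v h : R) : R * R * R :=
  ((q.1 : nat)%:R + u, (q.2 : nat)%:R + v, h).

Definition knot_mosaic (n : nat) (M : 'I_n * 'I_n -> tile) : Prop :=
  [/\ suitably_connected (@plane_mid2 n) M,
      forall q s, connection (M q) s ->
        let: (x, y) := plane_mid2 q s in (0 < x < 2 * n)%N && (0 < y < 2 * n)%N
    & single_curve (@plane_mid2 n) M].

(** * Spherical mosaics *)

Inductive face := faceX0 | faceX1 | faceY0 | faceY1 | faceZ0 | faceZ1.

Definition face_code (f : face) : bool * option bool :=
  match f with
  | faceX0 => (false, None) | faceX1 => (true, None)
  | faceY0 => (false, Some false) | faceY1 => (true, Some false)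
  | faceZ0 => (false, Some true) | faceZ1 => (true, Some true)
  end.
Definition face_decode (c : bool * option bool) : face :=
  match c with
  | (false, None) => faceX0 | (true, None) => faceX1
  | (false, Some false) => faceY0 | (true, Some false) => faceY1
  | (false, Some true) => faceZ0 | (true, Some true) => faceZ1
  end.
Lemma face_codeK : cancel face_code face_decode. Proof. by case. Qed.
HB.instance Definition _ := Finite.copy face (can_type face_codeK).

(* The point at height [h] above the point with coordinates [(a, b)] of a face
   of the cube [0, N]^3. The [a]-axis, the [b]-axis and the outward normal form
   a right-handed frame: seen from outside, [a] points right and [b] up. *)
Definition cube_point (A : zmodType) (N : A) (f : face) (a b h : A) :
    A * A * A :=
  match f with
  | faceX0 => (- h, b, a)
  | faceX1 => (N + h, a, b)
  | faceY0 => (a, - h, b)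
  | faceY1 => (b, N + h, a)
  | faceZ0 => (b, a, - h)
  | faceZ1 => (a, b, N + h)
  end.

Definition cube_mid2 (n : nat) (q : face * 'I_n * 'I_n) (s : side) :
    int * int * int :=
  let: (f, i, j) := q in
  cube_point (2 * n)%N%:Z f (2 * i + (side_mid2 s).1)%N%:Z
    (2 * j + (side_mid2 s).2)%N%:Z 0.

Definition cube_chart (R : realType) (n : nat) (q : face * 'I_n * 'I_n)
    (u v h : R) : R * R * R :=
  let: (f, i, j) := q in
  cube_point n%:R f ((i : nat)%:R + u) ((j : nat)%:R + v) h.

Definition spherical_knot_mosaic (n : nat) (M : face * 'I_n * 'I_n -> tile) :
    Prop :=
  suitably_connected (@cube_mid2 n) M /\ single_curve (@cube_mid2 n) M.

(** * Tiling numbers *)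

(* The least element of a set of natural numbers, as an infimum in the extended
   reals; it is +oo iff there is no mosaic representing [K]. *)
Definition tiling_number (R : realType) (K : set (R * R * R * R)) : \bar R :=
  ereal_inf [set (k%:R)%:E | k in
    [set k : nat | exists (n : nat) (M : 'I_n * 'I_n -> tile),
       [/\ (0 < n)%N, knot_mosaic M, represents (@plane_chart R n) M K
         & tile_count M = k]]].

Definition spherical_tiling_number (R : realType) (K : set (R * R * R * R)) :
    \bar R :=
  ereal_inf [set (k%:R)%:E | k in
    [set k : nat | exists (n : nat) (M : face * 'I_n * 'I_n -> tile),
       [/\ (0 < n)%N, spherical_knot_mosaic M, represents (@cube_chart R n) M K
         & tile_count M = k]]].

(* Main.v *)
Require Import Defs.
From mathcomp Require Import all_boot all_order all_algebra.
From mathcomp Require Import all_classical all_reals all_analysis.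
From mathcomp Require Import ring lra zify.

(** Every knot mosaic can be folded around a vertex of a cube so that one
non-empty tile disappears.

Let c be the leftmost non-empty square of the topmost non-empty row. It has no
connection point on its left or upper side, so that its tile is [T2], a single
arc from the right side to the lower side. The quadrant of the plane up and left
of the lower right vertex v of c contains no other non-empty square. Cut this
quadrant out and glue its two boundary rays to each other: the other three
quadrants become the three faces of a cube at a vertex, and the two ends of the
arc of c are the same point of the gluing edge. The diagram without c is hence a
spherical knot mosaic with one non-empty tile less
([cube_spherical_knot_mosaic], [cube_tile_count]).

The knot type is unchanged because the paper can be folded by an ambient
isotopy ([tame_unfold]). The isotopies move all points of space parallel to one
direction, in an increasing way on each line; those of at most linear growth
extend to the 3-sphere ([line_tame], [shear_tame]). Four shears, [bend],
[tuck], [turn] and [straighten], fold a sheet of paper; being piecewise linear,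
they carry the three quadrants rigidly to the faces, along with the
over-strands, which near a tile boundary stay below their distance to it.
No homeomorphism can contract the arc of c to a point. Therefore [lower] folds
down the upper right quadrant only away from the gluing edge. The arc of c and
the first bit of the chord r that continues it to the right are then two sides
of a thin triangle, whose third side is the image of this bit on the cube. The
isotopy [flatten] pushes the two sides onto the third one. So the arc of c and
the first bit of r together fill the first bit of r on the cube, and all the
other points of the diagram go to their copies
([fold_left_down], [fold_right_up], [fold_right_down], [fold_corner],
[fold_chord_before], [fold_chord_after]). *)

Set Implicit Arguments.
Unset Strict Implicit.
Unset Printing Implicit Defensive.

Import Order.TTheory GRing.Theory Num.Theory.
Import numFieldNormedType.Exports.

(** * Gluing a plane mosaic around a vertex of the cube *)

(** The upper right quadrant is glued to its face with a quarter turn. *)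
Definition rot_side (s : side) : side :=
  match s with
  | sideL => sideD | sideD => sideR | sideR => sideU | sideU => sideL
  end.

Definition rot_tile (t : tile) : tile :=
  match t with
  | T0 => T0 | T1 => T2 | T2 => T3 | T3 => T4 | T4 => T1 | T5 => T6 | T6 => T5
  | T7 => T8 | T8 => T7 | T9 => T10 | T10 => T9
  end.

Lemma connection_rot t s :
  connection (rot_tile t) (rot_side s) = connection t s.
Proof. by case: t; case: s. Qed.

Lemma joins_rot t s s' :
  has (fun a => joins a (rot_side s) (rot_side s')) (arcs (rot_tile t)) =
  has (fun a => joins a s s') (arcs t).
Proof. by case: t; case: s; case: s'. Qed.

Lemma nonempty_rot t : nonempty_tile (rot_tile t) = nonempty_tile t.
Proof. by case: t. Qed.

Lemma connection_nonempty t s : connection t s -> nonempty_tile t.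
Proof. by case: t. Qed.

Section Corner.
Variables (n : nat) (M : 'I_n.+1 * 'I_n.+1 -> tile).
Hypothesis hM : knot_mosaic M.
Implicit Types (q r : 'I_n.+1 * 'I_n.+1) (k l : face * 'I_n.+1 * 'I_n.+1).
Implicit Types s t : side.

(** The quadrant to be cut out: up and left of the lower right vertex of [c].
*)
Definition quadrant (c q : 'I_n.+1 * 'I_n.+1) := (q.1 <= c.1) && (c.2 <= q.2).

Definition corner (c : 'I_n.+1 * 'I_n.+1) :=
  [/\ M c = T2, forall q, nonempty_tile (M q) -> q.2 <= c.2
    & forall q, quadrant c q -> nonempty_tile (M q) -> q = c].

Lemma connection_interior q s : connection (M q) s ->
  (0 < (plane_mid2 q s).1 < 2 * n.+1) && (0 < (plane_mid2 q s).2 < 2 * n.+1).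
Proof. by case: hM => _ + _ => /(_ q s) h /h; case: plane_mid2. Qed.

(** The corner is found as the maximum of a weight in which the row counts
first. Its tile has no connection on the left or the upper side, as the
neighbour there would be non-empty; only [T2] is left. *)
Lemma exists_corner : exists c, corner c.
Proof.
case: (hM) => suit _ [[[q0 s0] /= /connection_nonempty q0P] _].
pose w q := q.2 * n.+1 + (n - q.1).
have [c [cP cmax]] : exists c, nonempty_tile (M c) /\
    forall q, nonempty_tile (M q) -> w q <= w c.
  by case: (arg_maxnP w (P := fun q => nonempty_tile (M q)) q0P) => c; exists c.
have top q : nonempty_tile (M q) -> q.2 <= c.2.
  move=> /cmax; rewrite /w => wq; rewrite leqNgt; apply/negP => lt.
  have := leq_mul lt (leqnn n.+1); rewrite mulSn; lia.
have HD q : quadrant c q -> nonempty_tile (M q) -> q = c.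
  move=> /andP[q1 q2] qP.
  have q2c : q.2 = c.2 by apply/ord_inj/eqP; rewrite eqn_leq q2 top.
  have q1c : q.1 = c.1.
    apply/ord_inj; have := cmax _ qP; rewrite /w q2c leq_add2l.
    by have := ltn_ord q.1; have := ltn_ord c.1; move: q1; lia.
  by rewrite [q]surjective_pairing q1c q2c -surjective_pairing.
exists c; split => //.
have noU : ~~ connection (M c) sideU.
  apply/negP => cU; have := connection_interior cU; rewrite /= => /andP[_ b].
  have b1 : c.2.+1 < n.+1 by lia.
  pose r : 'I_n.+1 * 'I_n.+1 := (c.1, Ordinal b1).
  have e : plane_mid2 c sideU = plane_mid2 r sideD.
    by rewrite /plane_mid2 /=; congr pair; lia.
  have rD : quadrant c r by rewrite /quadrant /= leqnn leqnSn.
  move: cU; rewrite (suit _ _ _ _ e) => /connection_nonempty /(HD _ rD).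
  by move/(congr1 (fun x => val x.2)) => /=; lia.
have noL : ~~ connection (M c) sideL.
  apply/negP => cL; have := connection_interior cL; rewrite /= => /andP[b _].
  have b1 : c.1.-1 < n.+1 by have := ltn_ord c.1; lia.
  pose r : 'I_n.+1 * 'I_n.+1 := (Ordinal b1, c.2).
  have e : plane_mid2 c sideL = plane_mid2 r sideR.
    by rewrite /plane_mid2 /=; congr pair; lia.
  have rD : quadrant c r by rewrite /quadrant /= leqnn leq_pred.
  move: cL; rewrite (suit _ _ _ _ e) => /connection_nonempty /(HD _ rD).
  by move/(congr1 (fun x => val x.1)) => /=; lia.
by move: cP noU noL; case: (M c).
Qed.

Variable c : 'I_n.+1 * 'I_n.+1.
Hypothesis hc : corner c.

(** A condition on points rather than on sides of squares, so that it can be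
carried from the plane to the cube. *)
Definition joint (P : nat * nat) : Prop :=
  exists q s, connection (M q) s /\ plane_mid2 q s = P.

Lemma joint_connection q s : joint (plane_mid2 q s) -> connection (M q) s.
Proof. by case: hM => suit _ _ [r [t [rt e]]]; rewrite -(suit _ _ _ _ e). Qed.

(** Nothing lies above the row of [c], so that the tile on the right of [c]
continues its arc by a single flat chord, without a crossing. *)
Lemma right_square : exists r, [/\ r.1 = c.1.+1 :> nat, r.2 = c.2
  & M r = T1 \/ M r = T5].
Proof.
have [suit _ _] := hM; have [cT top HD] := hc.
have cR : connection (M c) sideR by rewrite cT.
have := connection_interior cR; rewrite /= => /andP[b _].
have b1 : c.1.+1 < n.+1 by lia.
pose r : 'I_n.+1 * 'I_n.+1 := (Ordinal b1, c.2); exists r; split => //.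
have e : plane_mid2 c sideR = plane_mid2 r sideL.
  by rewrite /plane_mid2 /=; congr pair; lia.
have rL : connection (M r) sideL by rewrite -(suit _ _ _ _ e).
have rU : ~~ connection (M r) sideU.
  apply/negP => rU; have := connection_interior rU; rewrite /= => /andP[_ b'].
  have b2 : c.2.+1 < n.+1 by lia.
  pose r' : 'I_n.+1 * 'I_n.+1 := (Ordinal b1, Ordinal b2).
  have e' : plane_mid2 r sideU = plane_mid2 r' sideD.
    by rewrite /plane_mid2 /=; congr pair; lia.
  move: rU; rewrite (suit _ _ _ _ e') => /connection_nonempty /top /=.
  by rewrite ltnn.
by move: rL rU; case: (M r) => //; [left|right].
Qed.

Lemma down_square : exists r, [/\ r.1 = c.1, r.2.+1 = c.2 :> nat
  & connection (M r) sideU].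
Proof.
have [suit _ _] := hM; have [cT top HD] := hc.
have cD : connection (M c) sideD by rewrite cT.
have := connection_interior cD; rewrite /= => /andP[_ b].
have b1 : c.2.-1 < n.+1 by have := ltn_ord c.2; lia.
pose r : 'I_n.+1 * 'I_n.+1 := (c.1, Ordinal b1); exists r; split => //.
  by rewrite /=; lia.
have e : plane_mid2 c sideD = plane_mid2 r sideU.
  by rewrite /plane_mid2 /=; congr pair; lia.
by rewrite -(suit _ _ _ _ e).
Qed.

Lemma above_right_no_left q : q.1 = c.1.+1 :> nat -> c.2 < q.2 ->
  ~~ connection (M q) sideL.
Proof.
have [suit _ _] := hM; have [cT top HD] := hc.
move=> q1 q2; apply/negP => /connection_nonempty /top.
by rewrite leqNgt q2.
Qed.

(** These two ends of the arc of [c] are the only points at which the curve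
meets the boundary of the quadrant, and the gluing identifies them. *)
Lemma joint_quadrant P : joint P -> P.1 <= 2 * c.1.+1 -> 2 * c.2 <= P.2 ->
  P = (2 * c.1.+1, (2 * c.2).+1)%N \/ P = ((2 * c.1).+1, 2 * c.2)%N.
Proof.
move=> Pon P1 P2; have [cT top HD] := hc.
(* Each joint on the boundary of the quadrant lies on a side of a square of the
   quadrant, and [c] is the only one with arcs. *)
suff [r [t [rD e]]] : exists r t, quadrant c r /\ plane_mid2 r t = P.
  have rt : connection (M r) t by apply: joint_connection; rewrite e.
  have rc := HD _ rD (connection_nonempty rt); move: rt; rewrite -e rc cT.
  by case: t {e} => // _; [left|right]; rewrite /plane_mid2 /=; congr pair; lia.
case: Pon => q [s [qs e]]; rewrite -e in P1 P2 *.
have bq := connection_interior qs.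
have [qD|] := boolP (quadrant c q); first by exists q, s.
move: bq P1 P2 {e}; case: q {qs} => q1 q2.
rewrite /quadrant /= negb_and -!ltnNge.
move=> /andP[bx by_] P1 P2 out.
have b1 : c.1 < n.+1 := ltn_ord c.1.
have b2 : q2 < n.+1 := ltn_ord q2.
case: s bx by_ P1 P2 => /= bx by_ P1 P2.
- exists (c.1, q2), sideR; rewrite /quadrant /plane_mid2 /=.
  by split; [lia|congr pair; lia].
- lia.
- exists (q1, c.2), sideD; rewrite /quadrant /plane_mid2 /=.
  by split; [lia|congr pair; lia].
- lia.
Qed.

(** [glued q k] says that the square [q] of the plane is put on the square [k]
of the cube. The lower right vertex of [c] goes to the point (0, N, N), where N
= n + 1. The equations are additive because of truncated subtraction. *)
Definition glued q (k : face * 'I_n.+1 * 'I_n.+1) : bool :=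
  let: (f, a, b) := k in
  match f with
  | faceX0 => [&& (q.1 <= c.1), (q.2 < c.2), (a + c.1.+1 == n.+1 + q.1)
                & (b + c.2 == n.+1 + q.2)]
  | faceY1 => [&& (c.1 < q.1), (c.2 <= q.2), (a + q.2 == n + c.2)
                & (q.1 == b + c.1.+1 :> nat)]
  | faceZ1 => [&& (c.1 < q.1), (q.2 < c.2), (q.1 == a + c.1.+1 :> nat)
                & (b + c.2 == n.+1 + q.2)]
  | _ => false
  end.

Lemma glued_out q k : glued q k -> ~~ quadrant c q.
Proof.
by rewrite /quadrant; case: k => [[[] a] b] //= /and4P[]; lia.
Qed.

Lemma glued_injl q r k : glued q k -> glued r k -> q = r.
Proof.
case: q k r => [q1 q2] [[f a] b] [r1 r2] h h'.
by congr pair; apply/ord_inj; move: h h'; case: f => //=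
  /and4P[] ? ? /eqP ? /eqP ? /and4P[] ? ? /eqP ? /eqP ?; lia.
Qed.

Lemma glued_injr q k l : glued q k -> glued q l -> k = l.
Proof.
case: q k l => [q1 q2] [[f a] b] [[f' a'] b'] h h'.
have e : f = f'.
  by move: h h'; case: f; case: f' => //=
    /and4P[] ? ? _ _ /and4P[] ? ? _ _; lia.
rewrite -e in h' *.
by congr (_, _, _); apply/ord_inj; move: h h'; case: f {e} => //=
  /and4P[] ? ? /eqP ? /eqP ? /and4P[] ? ? /eqP ? /eqP ?; lia.
Qed.

Lemma glued_exists q : ~~ quadrant c q -> exists k, glued q k.
Proof.
case: q => q1 q2; rewrite /quadrant /= negb_and -!ltnNge => out.
have [l1 l2] := (ltn_ord q1, ltn_ord q2).
have [m1 m2] := (ltn_ord c.1, ltn_ord c.2).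
have [lt1|ge1] := ltnP c.1 q1; last first.
  have a1 : n.+1 + q1 - c.1.+1 < n.+1 by lia.
  have a2 : n.+1 + q2 - c.2 < n.+1 by lia.
  by exists (faceX0, Ordinal a1, Ordinal a2) => /=; apply/and4P; split; lia.
have [lt2|ge2] := ltnP q2 c.2.
  have a1 : q1 - c.1.+1 < n.+1 by lia.
  have a2 : n.+1 + q2 - c.2 < n.+1 by lia.
  by exists (faceZ1, Ordinal a1, Ordinal a2) => /=; apply/and4P; split; lia.
have a1 : n + c.2 - q2 < n.+1 by lia.
have a2 : q1 - c.1.+1 < n.+1 by lia.
by exists (faceY1, Ordinal a1, Ordinal a2) => /=; apply/and4P; split; lia.
Qed.

Definition turn_side (f : face) (s : side) :=
  if f == faceY1 then rot_side s else s.
Definition turn_tile (f : face) (t : tile) :=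
  if f == faceY1 then rot_tile t else t.

Definition cube_mosaic (k : face * 'I_n.+1 * 'I_n.+1) : tile :=
  if [pick q | glued q k] is Some q then turn_tile k.1.1 (M q) else T0.

Lemma cube_mosaicE q k : glued q k -> cube_mosaic k = turn_tile k.1.1 (M q).
Proof.
move=> h; rewrite /cube_mosaic; case: pickP => [r /glued_injl/(_ h) -> //|].
by move=> /(_ q); rewrite h.
Qed.

Lemma cube_mosaic_glued k : nonempty_tile (cube_mosaic k) ->
  exists q, glued q k.
Proof. by rewrite /cube_mosaic; case: pickP => // q h _; exists q. Qed.

Lemma connection_turn f (u : tile) s :
  connection (turn_tile f u) (turn_side f s) = connection u s.
Proof.
by rewrite /turn_tile /turn_side; case: ifP => // _; rewrite connection_rot.
Qed.

Lemma turn_side_surj f s : exists s', s = turn_side f s'.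
Proof.
rewrite /turn_side; case: (f == faceY1); last by exists s.
by case: s; [exists sideU|exists sideD|exists sideR|exists sideL].
Qed.

Local Open Scope ring_scope.

(** The gluing map on midpoints. On each of the three closed quadrants it is an
isometry into a face, and it takes the two ends of the arc of [c] to the same
point. *)
Definition glue (P : nat * nat) : int * int * int :=
  let x : int := P.1%:Z - (2 * c.1.+1)%N%:Z in
  let y : int := P.2%:Z - (2 * c.2)%N%:Z in
  let m : int := (2 * n.+1)%N%:Z in
  (Num.max x 0, m + Num.min y 0, m - Num.max y 0 + Num.min x 0).

Lemma cube_mid2_glued q k s : glued q k ->
  cube_mid2 k (turn_side k.1.1 s) = glue (plane_mid2 q s).
Proof.
case: q k => [q1 q2] [[f a] b]; rewrite /turn_side.
by case: f => //= /and4P[h1 h2 /eqP h3 /eqP h4]; case: s;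
  rewrite /glue /=; congr (_, _, _); lia.
Qed.

Lemma cube_joint k s : connection (cube_mosaic k) s ->
  exists P, joint P /\ cube_mid2 k s = glue P.
Proof.
move=> ks; have [q qk] := cube_mosaic_glued (connection_nonempty ks).
have [t e] := turn_side_surj k.1.1 s.
exists (plane_mid2 q t); split; last by rewrite e (cube_mid2_glued _ qk).
exists q, t; split => //.
by move: ks; rewrite (cube_mosaicE qk) e connection_turn.
Qed.

Lemma joint_bounds P : joint P ->
  (0 < P.1 < 2 * n.+1)%N && (0 < P.2 < 2 * n.+1)%N.
Proof. by case=> q [s [qs <-]]; exact: connection_interior. Qed.

Lemma joint_right : joint (2 * c.1.+1, (2 * c.2).+1)%N.
Proof.
have [cT _ _] := hc; exists c, sideR; rewrite cT; split => //.
by rewrite /plane_mid2 /=; congr pair; lia.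
Qed.

Lemma joint_down : joint ((2 * c.1).+1, 2 * c.2)%N.
Proof.
have [cT _ _] := hc; exists c, sideD; rewrite cT; split => //.
by rewrite /plane_mid2 /=; congr pair; lia.
Qed.

Lemma cube_joint_glued q k s t P : glued q k -> s = turn_side k.1.1 t ->
  joint P -> P = plane_mid2 q t -> connection (cube_mosaic k) s.
Proof.
move=> qk -> Pon e; rewrite (cube_mosaicE qk) connection_turn.
by apply: joint_connection; rewrite -e.
Qed.

(** From here on, an occupied midpoint on the cube is traced back to the square
of the plane whose image has this midpoint on its side. The square lies in the
grid since the curve does not touch the boundary of the grid. *)
Lemma cube_joint_left (a b : 'I_n.+1) s P : joint P ->
  (P.1 <= 2 * c.1.+1)%N -> (P.2 <= 2 * c.2)%N ->
  (2 * a + (side_mid2 s).1 + 2 * c.1.+1 = 2 * n.+1 + P.1)%N ->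
  (2 * b + (side_mid2 s).2 + 2 * c.2 = 2 * n.+1 + P.2)%N ->
  connection (cube_mosaic (faceX0, a, b)) s.
Proof.
move=> Pon; have := joint_bounds Pon; case: P Pon => X Y Pon /=.
move=> /andP[/andP[X0 Xn] /andP[Y0 Yn]] Xc Yc ea eb.
have [l1 l2] := (ltn_ord c.1, ltn_ord c.2).
have [la lb] := (ltn_ord a, ltn_ord b).
have q1 : (a + c.1.+1 - n.+1 < n.+1)%N by lia.
have q2 : (b + c.2 - n.+1 < n.+1)%N by lia.
apply: (@cube_joint_glued (Ordinal q1, Ordinal q2) _ _ s _ _ _ Pon) => //=.
  by apply/and4P; split; case: s ea eb => /= ea eb; lia.
by rewrite /plane_mid2 /=; congr pair; case: s ea eb => /= ea eb; lia.
Qed.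

Lemma cube_joint_right (a b : 'I_n.+1) s P : joint P ->
  (2 * c.1.+1 <= P.1)%N -> (2 * c.2 <= P.2)%N ->
  (2 * b + (side_mid2 s).2 + 2 * c.1.+1 = P.1)%N ->
  (2 * a + (side_mid2 s).1 + P.2 = 2 * n.+1 + 2 * c.2)%N ->
  connection (cube_mosaic (faceY1, a, b)) s.
Proof.
move=> Pon; have := joint_bounds Pon; case: P Pon => X Y Pon /=.
move=> /andP[/andP[X0 Xn] /andP[Y0 Yn]] Xc Yc ea eb.
have [l1 l2] := (ltn_ord c.1, ltn_ord c.2).
have [la lb] := (ltn_ord a, ltn_ord b).
have q1 : (b + c.1.+1 < n.+1)%N by lia.
have q2 : (n + c.2 - a < n.+1)%N by case: s ea eb => /= ea eb; lia.
have [t st] := turn_side_surj faceY1 s.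
apply: (@cube_joint_glued (Ordinal q1, Ordinal q2) (faceY1, a, b)
  _ t _ _ st Pon) => //=.
  by apply/and4P; split; case: s {st} ea eb => /= ea eb; lia.
by rewrite /plane_mid2 /=; congr pair; case: t st => st;
  rewrite st /= in ea eb *; lia.
Qed.

Lemma cube_joint_top (a b : 'I_n.+1) s P : joint P ->
  (2 * c.1.+1 <= P.1)%N -> (P.2 <= 2 * c.2)%N ->
  (2 * a + (side_mid2 s).1 + 2 * c.1.+1 = P.1)%N ->
  (2 * b + (side_mid2 s).2 + 2 * c.2 = 2 * n.+1 + P.2)%N ->
  connection (cube_mosaic (faceZ1, a, b)) s.
Proof.
move=> Pon; have := joint_bounds Pon; case: P Pon => X Y Pon /=.
move=> /andP[/andP[X0 Xn] /andP[Y0 Yn]] Xc Yc ea eb.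
have [l1 l2] := (ltn_ord c.1, ltn_ord c.2).
have [la lb] := (ltn_ord a, ltn_ord b).
have q1 : (a + c.1.+1 < n.+1)%N by lia.
have q2 : (b + c.2 - n.+1 < n.+1)%N by lia.
apply: (@cube_joint_glued (Ordinal q1, Ordinal q2) _ _ s _ _ _ Pon) => //=.
  by apply/and4P; split; case: s ea eb => /= ea eb; lia.
by rewrite /plane_mid2 /=; congr pair; case: s ea eb => /= ea eb; lia.
Qed.

(** [glue] identifies no two joints other than the ends of the arc of [c]. So a
side of a square of the cube at the image of a joint is the image of a side at
this joint, or at the other end of the arc of [c]. *)
Lemma cube_joint_connection k s P : joint P -> cube_mid2 k s = glue P ->
  connection (cube_mosaic k) s.
Proof.
move=> Pon; have := joint_bounds Pon; have onQ := joint_quadrant Pon.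
have [l1 l2] := (ltn_ord c.1, ltn_ord c.2).
case: P Pon onQ => X Y Pon onQ /= /andP[/andP[X0 Xn] /andP[Y0 Yn]].
case: k => [[f a] b]; rewrite /glue /=; have [la lb] := (ltn_ord a, ltn_ord b).
case: f => /= -[ex ey ez].
- have [Yc|Yc] := leqP Y (2 * c.2).
    by apply: (cube_joint_left Pon) => /=; lia.
  have /= [||[eX eY]|[eX eY]] := onQ; [lia|lia| |lia].
  by apply: (cube_joint_left joint_down) => /=; lia.
- lia.
- lia.
- have [Xc|Xc] := leqP (2 * c.1.+1) X.
    by apply: (cube_joint_right Pon) => /=; lia.
  have /= [||[eX eY]|[eX eY]] := onQ; [lia|lia|lia|].
  by apply: (cube_joint_right joint_right) => /=; lia.
- have [Xc|Xc] := leqP (2 * c.1.+1) X; first lia.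
  have [Yc|Yc] := leqP (2 * c.2) Y; last lia.
  have /= [||[eX eY]|[eX eY]] := onQ; lia.
- by apply: (cube_joint_top Pon) => /=; lia.
Qed.

(** Both sides of the equality say that the common midpoint is the image of a
joint, a condition that does not mention the squares. *)
Lemma cube_suitable : suitably_connected (@cube_mid2 n.+1) cube_mosaic.
Proof.
have imp k l s t : cube_mid2 k s = cube_mid2 l t ->
    connection (cube_mosaic k) s -> connection (cube_mosaic l) t.
  move=> e /cube_joint[P [Pon eP]].
  by apply: (cube_joint_connection Pon); rewrite -e.
by move=> k l s t e; apply/idP/idP; apply: imp.
Qed.

Lemma cube_tile_count : (tile_count cube_mosaic < tile_count M)%N.
Proof.
have [cT top HD] := hc.
pose f k := odflt c [pick q | glued q k].
have fE k : k \in [pred k | nonempty_tile (cube_mosaic k)] -> glued (f k) k.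
  rewrite inE => /cube_mosaic_glued[q qk]; rewrite /f.
  by case: pickP => //= /(_ q); rewrite qk.
(* [f] embeds the non-empty squares of the cube into those of the plane and
   misses [c]. *)
rewrite /tile_count -(card_in_imset (f := f)); last first.
  by move=> k l /fE h /fE h' e; rewrite e in h; exact: glued_injr h h'.
apply/proper_card/properP; split.
  apply/fintype.subsetP => q /imsetP[k kP ->]; have h := fE _ kP.
  move: kP; rewrite !inE (cube_mosaicE h) /turn_tile.
  by case: ifP => // _; rewrite nonempty_rot.
exists c; first by rewrite inE cT.
apply/negP => /imsetP[k kP e]; have := glued_out (fE _ kP).
by rewrite -e /quadrant !leqnn.
Qed.

(** A path along the plane curve is followed on the cube. A passage through [c]
goes between midpoints with the same image and costs no step. *)
Lemma cube_connect x y (k l : face * 'I_n.+1 * 'I_n.+1 * side) :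
  connect (curve_step (@plane_mid2 n.+1) M) x y ->
  cube_mid2 k.1 k.2 = glue (plane_mid2 x.1 x.2) ->
  cube_mid2 l.1 l.2 = glue (plane_mid2 y.1 y.2) ->
  connect (curve_step (@cube_mid2 n.+1) cube_mosaic) k l.
Proof.
have [cT top HD] := hc.
have same (u v : face * 'I_n.+1 * 'I_n.+1 * side) :
    cube_mid2 u.1 u.2 = cube_mid2 v.1 v.2 ->
    connect (curve_step (@cube_mid2 n.+1) cube_mosaic) u v.
  by move=> e; apply: connect1; rewrite /curve_step e eqxx orbT.
move=> /connectP[p + ->]; elim: p x k => [|z p IH] x k /=.
  by move=> _ ex ey; apply: same; rewrite ex ey.
move=> /andP[/orP[/andP[/eqP xz h]|/eqP e] zp] ex ey; last first.
  by apply: (IH z) => //; rewrite -e.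
have [xD|xD] := boolP (quadrant c x.1).
  apply: (IH z) => //; rewrite ex -xz.
  have xc : x.1 = c.
    by apply: HD => //; move: h; case: (M x.1).
  move: h; rewrite xc cT; case: x.2; case: z.2 => //= _;
    by rewrite /glue /=; congr (_, _, _); lia.
have [k' gk] := glued_exists xD.
have arc : connect (curve_step (@cube_mid2 n.+1) cube_mosaic)
    (k', turn_side k'.1.1 x.2) (k', turn_side k'.1.1 z.2).
  apply: connect1; rewrite /curve_step /= eqxx (cube_mosaicE gk).
  rewrite /turn_side /turn_tile; case: (k'.1.1 == faceY1); last by rewrite h.
  by rewrite joins_rot h.
apply: connect_trans (connect_trans _ arc) (IH z _ zp _ ey).
  by apply: same; rewrite ex /= (cube_mid2_glued _ gk).
by rewrite /= (cube_mid2_glued _ gk) xz.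
Qed.

Lemma cube_spherical_knot_mosaic : @spherical_knot_mosaic n.+1 cube_mosaic.
Proof.
have [_ _ [_ conn]] := hM.
split; first exact: cube_suitable.
split.
  have [r [r1 r2 rU]] := down_square.
  have rD : ~~ quadrant c r by rewrite /quadrant; lia.
  have [k gk] := glued_exists rD; exists (k, turn_side k.1.1 sideU).
  by rewrite /= (cube_mosaicE gk) connection_turn.
move=> x y /cube_joint[P [[q [s [qs <-]]] eP]].
move=> /cube_joint[Q [[r [t [rt <-]]] eQ]].
exact: (cube_connect (conn (q, s) (r, t) qs rt) eP eQ).
Qed.

End Corner.

Local Open Scope classical_set_scope.
Local Open Scope ring_scope.

(** * Ambient isotopies of the 3-sphere *)

Lemma within_continuous_comp (T U V : topologicalType) (A : set T) (B : set U)
    (f : T -> U) (g : U -> V) :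
  set_fun A B f -> {within A, continuous f} -> {within B, continuous g} ->
  {within A, continuous (g \o f)}.
Proof.
move=> fAB /subspace_continuousP fc /subspace_continuousP gc.
apply/subspace_continuousP => x Ax W /= gW.
have h := fc _ Ax _ (gc _ (fAB _ Ax) _ gW).
move: h; rewrite /nbhs /= /fmap /= /within /=; apply: filterS => y h Ay.
by apply: h => //; exact: fAB.
Qed.

Lemma within_continuous_pair (T U V : topologicalType) (A : set T)
    (f : T -> U) (g : T -> V) :
  {within A, continuous f} -> {within A, continuous g} ->
  {within A, continuous (fun x => (f x, g x))}.
Proof.
move=> /subspace_continuousP fc /subspace_continuousP gc.
by apply/subspace_continuousP => x Ax; apply: cvg_pair; [exact: fc|exact: gc].
Qed.

Lemma homeomorphism_comp (T U V : topologicalType) (A : set T) (B : set U)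
    (C : set V) (f : T -> U) (g : U -> V) :
  homeomorphism A B f -> homeomorphism B C g -> homeomorphism A C (g \o f).
Proof.
move=> [f' [[fc fc'] [fS fS'] fK fK']] [g' [[gc gc'] [gS gS'] gK gK']].
exists (f' \o g'); split.
- by split; [apply: within_continuous_comp fS _ _|
             apply: within_continuous_comp gS' _ _].
- by split=> x ?; [exact/gS/fS|exact/fS'/gS'].
- by move=> x Ax /=; rewrite gK ?fK//; exact: fS.
- by move=> x Ax /=; rewrite fK' ?gK'//; exact: gS'.
Qed.

(** The two isotopies run simultaneously, one after the other at each time;
this avoids joining two time intervals. *)
Lemma ambient_isotopic_trans (R : realType) (K L M : set (R * R * R * R)) :
  K `<=` @sphere3 R ->
  ambient_isotopic K L -> ambient_isotopic L M -> ambient_isotopic K M.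
Proof.
move=> KS [F [Fc Fh F0 F1]] [G [Gc Gh G0 G1]].
have FS t p : `[0, 1]%classic t -> sphere3 p -> sphere3 (F (t, p)).
  by move=> tI pS; have [_ [_ [h _] _ _]] := Fh _ tI; exact: h.
exists (fun tp => G (tp.1, F tp)); split.
- change {within `[0, 1]%classic `*` @sphere3 R,
    continuous (G \o (fun tp => (tp.1, F tp)))}.
  apply: (within_continuous_comp _ _ Gc).
  + by move=> [t p] [tI pS]; split => //; exact: FS.
  + apply: within_continuous_pair => //.
    by apply: continuous_subspaceT => x; exact: cvg_fst.
- by move=> t tI; exact: homeomorphism_comp (Fh _ tI) (Gh _ tI).
- by move=> p pS /=; rewrite F0// G0.
- rewrite -G1 -F1; apply/seteqP; split=> q [p pK <-] /=.
    by exists (F (1, p)) => //; exists p.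
  by case: pK => x xK <-; exists x.
Qed.

Section Stereographic.
Variable R : realType.
Notation V := (R * R * R)%type.
Notation S := (R * R * R * R)%type.
Implicit Types (p : V) (q : S).

Definition sqnorm p : R := let: (x, y, z) := p in x ^+ 2 + y ^+ 2 + z ^+ 2.

(** Stereographic projection, a left inverse of [to_sphere3]. *)
Definition from_sphere3 q : V :=
  let: (x, y, z, w) := q in (x / (1 - w), y / (1 - w), z / (1 - w)).

Lemma sqnorm_ge0 p : 0 <= sqnorm p.
Proof. by case: p => [[x y] z] /=; rewrite !addr_ge0// sqr_ge0. Qed.

Lemma to_sphere3_sphere p : sphere3 (to_sphere3 p).
Proof.
have := sqnorm_ge0 p; case: p => [[x y] z] /= s0.
have s1 : x ^+ 2 + y ^+ 2 + z ^+ 2 + 1 != 0 by rewrite gt_eqF// ltr_wpDl.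
by rewrite /sphere3 /=; field.
Qed.

Lemma to_sphere3_last p : 1 - (to_sphere3 p).2 = 2 / (sqnorm p + 1).
Proof.
have := sqnorm_ge0 p; case: p => [[x y] z] /= s0.
have s1 : x ^+ 2 + y ^+ 2 + z ^+ 2 + 1 != 0 by rewrite gt_eqF// ltr_wpDl.
by field.
Qed.

Lemma to_sphere3_last_neq1 p : (to_sphere3 p).2 == 1 = false.
Proof.
apply/eqP => h; have := to_sphere3_last p; rewrite h subrr => /esym/eqP.
by rewrite gt_eqF// divr_gt0// ltr_wpDl// sqnorm_ge0.
Qed.

Lemma to_sphere3K : cancel (@to_sphere3 R) from_sphere3.
Proof.
move=> p; have := to_sphere3_last p; have := sqnorm_ge0 p.
case: p => [[x y] z] /= s0 ->.
have s1 : x ^+ 2 + y ^+ 2 + z ^+ 2 + 1 != 0 by rewrite gt_eqF// ltr_wpDl.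
by congr (_, _, _); field.
Qed.

Lemma from_sphere3K q : sphere3 q -> q.2 != 1 ->
  to_sphere3 (from_sphere3 q) = q.
Proof.
case: q => [[[x y] z] w]; rewrite /sphere3 /= => h w1.
have w1' : 1 - w != 0 by rewrite subr_eq0 eq_sym.
have -> : (x / (1 - w)) ^+ 2 + (y / (1 - w)) ^+ 2 + (z / (1 - w)) ^+ 2 =
   (1 + w) / (1 - w).
  have -> : (1 + w) / (1 - w) = (1 - w ^+ 2) / (1 - w) ^+ 2 by field.
  have -> : 1 - w ^+ 2 = x ^+ 2 + y ^+ 2 + z ^+ 2 by lra.
  by field.
have w2 : 1 + w + (1 - w) != 0.
  by rewrite (_ : _ + _ = 2) ?pnatr_eq0//; ring.
by congr (_, _, _, _); field; rewrite w1' w2.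
Qed.

Lemma sphere3_north q : sphere3 q -> q.2 = 1 -> q = (0, 0, 0, 1).
Proof.
case: q => [[[x y] z] w]; rewrite /sphere3 /= => + w1; rewrite w1 => h.
have h0 : x ^+ 2 + y ^+ 2 + z ^+ 2 = 0 by lra.
have [[x2 y2] z2] := (sqr_ge0 x, sqr_ge0 y, sqr_ge0 z).
have sq0 (a : R) : a ^+ 2 = 0 -> a = 0 by move/eqP; rewrite sqrf_eq0 => /eqP.
by congr (_, _, _, _); apply: sq0; lra.
Qed.

Lemma to_sphere3_continuous : continuous (@to_sphere3 R).
Proof.
move=> [[x y] z].
have s1 : x ^+ 2 + y ^+ 2 + z ^+ 2 + 1 != 0.
  by rewrite gt_eqF// ltr_wpDl// (sqnorm_ge0 (x, y, z)).
pose s p : R := p.1.1 ^+ 2 + p.1.2 ^+ 2 + p.2 ^+ 2.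
have cx : (fun p : V => p.1.1) @ nbhs (x, y, z) --> x.
  by apply: (@cvg_comp _ _ _ fst fst); exact: cvg_fst.
have cy : (fun p : V => p.1.2) @ nbhs (x, y, z) --> y.
  by apply: (@cvg_comp _ _ _ fst snd); [exact: cvg_fst|exact: cvg_snd].
have cz : (fun p : V => p.2) @ nbhs (x, y, z) --> z by exact: cvg_snd.
have cs : s @ nbhs (x, y, z) --> x ^+ 2 + y ^+ 2 + z ^+ 2.
  exact: (cvgD (cvgD (cvgM cx cx) (cvgM cy cy)) (cvgM cz cz)).
have cs1 : (fun p => (s p + 1)^-1) @ nbhs (x, y, z) -->
    (x ^+ 2 + y ^+ 2 + z ^+ 2 + 1)^-1.
  apply: (@cvgV _ _ _ _ (fun p => s p + 1)) => //.
  exact: (cvgD cs (cvg_cst _)).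
rewrite /continuous_at [X in X @ _](_ : _ = (fun p =>
   (2 * p.1.1 / (s p + 1), 2 * p.1.2 / (s p + 1), 2 * p.2 / (s p + 1),
    (s p - 1) / (s p + 1)))); last by apply/funext => -[[? ?] ?].
have c2 (f : V -> R) (a : R) : f @ nbhs (x, y, z) --> a ->
    (fun p => 2 * f p / (s p + 1)) @ nbhs (x, y, z) -->
    2 * a / (x ^+ 2 + y ^+ 2 + z ^+ 2 + 1).
  by move=> fa; exact: (cvgM (cvgM (@cvg_cst R 2 _ _ _) fa) cs1).
exact: (cvg_pair (cvg_pair (cvg_pair (c2 _ _ cx) (c2 _ _ cy)) (c2 _ _ cz))
  (cvgM (cvgB cs (@cvg_cst R 1 _ _ _)) cs1)).
Qed.

Lemma from_sphere3_continuous q : q.2 != 1 -> {for q, continuous from_sphere3}.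
Proof.
case: q => [[[x y] z] w] /= w1.
have w1' : 1 - w != 0 by rewrite subr_eq0 eq_sym.
set F := nbhs (x, y, z, w).
have cx : (fun q : S => q.1.1.1) @ F --> x.
  apply: (@cvg_comp _ _ _ fst (fun p : V => p.1.1)); first exact: cvg_fst.
  by apply: (@cvg_comp _ _ _ fst fst); exact: cvg_fst.
have cy : (fun q : S => q.1.1.2) @ F --> y.
  apply: (@cvg_comp _ _ _ fst (fun p : V => p.1.2)); first exact: cvg_fst.
  by apply: (@cvg_comp _ _ _ fst snd); [exact: cvg_fst|exact: cvg_snd].
have cz : (fun q : S => q.1.2) @ F --> z.
  by apply: (@cvg_comp _ _ _ fst snd); [exact: cvg_fst|exact: cvg_snd].
have cw : (fun q : S => q.2) @ F --> w by exact: cvg_snd.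
have cs1 : (fun q : S => (1 - q.2)^-1) @ F --> (1 - w)^-1.
  apply: (@cvgV _ _ _ _ (fun q : S => 1 - q.2)) => //.
  exact: (cvgB (cvg_cst _) cw).
rewrite /prop_for /continuous_at [X in X @ _](_ : _ = (fun q : S =>
   (q.1.1.1 / (1 - q.2), q.1.1.2 / (1 - q.2), q.1.2 / (1 - q.2))));
  last by apply/funext => -[[[? ?] ?] ?].
exact: (cvg_pair (cvg_pair (cvgM cx cs1) (cvgM cy cs1)) (cvgM cz cs1)).
Qed.

(** On the sphere the last coordinate w controls the others, as x ^+ 2 <= 1 - w
^+ 2 <= 2 * (1 - w). *)
Lemma cvg_north (T : Type) (F : set_system T) {FF : ProperFilter F}
    (e : T -> S) (d : T -> R) :
  d @ F --> (0 : R) ->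
  (\forall t \near F, sphere3 (e t) /\ 1 - (e t).2 <= d t) ->
  e @ F --> ((0, 0, 0, 1) : S).
Proof.
move=> d0 he.
have key (f : T -> R) : (\forall t \near F, f t ^+ 2 <= 2 * d t) ->
    f @ F --> (0 : R).
  move=> hf; apply/cvgrPdist_lt => eps e0.
  have e2 : 0 < eps ^+ 2 / 2 by rewrite divr_gt0// exprn_gt0.
  move/cvgrPdist_lt/(_ _ e2) : d0 => hd.
  near=> t.
  rewrite sub0r normrN -(@ltr_pXn2r _ 2)// ?nnegrE ?(ltW e0)//.
  rewrite -normrX ger0_norm ?sqr_ge0//.
  have h1 : f t ^+ 2 <= 2 * d t by near: t.
  have : `|0 - d t| < eps ^+ 2 / 2 by near: t.
  rewrite sub0r normrN => /(le_lt_trans (ler_norm _)); lra.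
have bnd x y z w : sphere3 ((x, y, z, w) : S) ->
  [/\ x ^+ 2 <= 2 * (1 - w), y ^+ 2 <= 2 * (1 - w), z ^+ 2 <= 2 * (1 - w)
    & 0 <= 1 - w].
  rewrite /sphere3 /= => h.
  have [[x2 y2] z2] := (sqr_ge0 x, sqr_ge0 y, sqr_ge0 z).
  by have := sqr_ge0 (1 - w); split; nra.
have k1 : (fun t => (e t).1.1.1) @ F --> (0 : R).
  apply: key; apply: filterS he => t; case: (e t) => [[[x y] z] w] [].
  by move=> /bnd[] /=; lra.
have k2 : (fun t => (e t).1.1.2) @ F --> (0 : R).
  apply: key; apply: filterS he => t; case: (e t) => [[[x y] z] w] [].
  by move=> /bnd[] /=; lra.
have k3 : (fun t => (e t).1.2) @ F --> (0 : R).
  apply: key; apply: filterS he => t; case: (e t) => [[[x y] z] w] [].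
  by move=> /bnd[] /=; lra.
have k4 : (fun t => (e t).2) @ F --> (1 : R).
  apply/cvgrPdist_lt => eps e0; move/cvgrPdist_lt/(_ _ e0) : d0 => hd.
  near=> t.
  have : `|0 - d t| < eps by near: t.
  rewrite sub0r normrN => /(le_lt_trans (ler_norm _)).
  have [] : sphere3 (e t) /\ 1 - (e t).2 <= d t by near: t.
  case: (e t) => [[[x y] z] w] /bnd[_ _ _ w0] /= wd.
  by rewrite ger0_norm//; exact: le_lt_trans.
rewrite [e](_ : _ = fun t => ((e t).1.1.1, (e t).1.1.2, (e t).1.2, (e t).2));
  last by apply/funext => t; case: (e t) => [[[? ?] ?] ?].
exact: (cvg_pair (cvg_pair (cvg_pair k1 k2) k3) k4).
Unshelve. all: by end_near. Qed.

(** The extension to the one-point compactification. *)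
Definition extend (h : V -> V) q : S :=
  if q.2 == 1 then q else to_sphere3 (h (from_sphere3 q)).

Lemma extend_sphere h q : sphere3 q -> sphere3 (extend h q).
Proof. by rewrite /extend; case: ifP => // _ _; exact: to_sphere3_sphere. Qed.

Lemma extend_to_sphere3 h p : extend h (to_sphere3 p) = to_sphere3 (h p).
Proof. by rewrite /extend to_sphere3_last_neq1 to_sphere3K. Qed.

Lemma extendK h g q : cancel h g -> sphere3 q -> extend g (extend h q) = q.
Proof.
move=> hK qS; rewrite {2}/extend; case: ifP => [q1|/negbT q1].
  by rewrite /extend q1.
by rewrite extend_to_sphere3 hK from_sphere3K.
Qed.

(** Since 1 - w = 2 / (sqnorm p + 1), a growth bound on the inverse of [h] is a
Lipschitz bound at the north pole. *)
Lemma extend_last (h : V -> V) (C : R) q :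
  (forall p, sqnorm p + 1 <= C * (sqnorm (h p) + 1)) ->
  sphere3 q -> 1 - (extend h q).2 <= C * (1 - q.2).
Proof.
move=> hC qS; rewrite /extend; case: ifP => [/eqP ->|/negbT q1].
  by rewrite subrr mulr0.
rewrite to_sphere3_last -{2}(from_sphere3K qS q1) to_sphere3_last.
set p := from_sphere3 q.
have s0 : 0 < sqnorm p + 1 by rewrite ltr_wpDl// sqnorm_ge0.
have s0' : 0 < sqnorm (h p) + 1 by rewrite ltr_wpDl// sqnorm_ge0.
rewrite mulrCA ler_pM2l// -ler_pdivrMr ?invr_gt0// invrK.
rewrite mulrC ler_pdivrMr//; exact: hC.
Qed.

(** The bound, uniform in time, says that far points stay far; it gives
continuity at the north pole. *)
Lemma extend_continuous (H : R * V -> V) (I : set R) (C : R) :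
  continuous H ->
  (forall t, I t -> forall p, sqnorm p + 1 <= C * (sqnorm (H (t, p)) + 1)) ->
  {within I `*` @sphere3 R,
    continuous (fun tq => extend (fun p => H (tq.1, p)) tq.2)}.
Proof.
move=> Hc HC; apply/subspace_continuousP => -[t q] [/= tI qS].
have c2 : (fun tq : R * S => tq.2.2) @ nbhs (t, q) --> q.2.
  by apply: (@cvg_comp _ _ _ snd snd); exact: cvg_snd.
have [q1|q1] := eqVneq q.2 1.
  have qN : extend (fun p => H (t, p)) q = (0, 0, 0, 1).
    by rewrite /extend q1 eqxx; exact: sphere3_north.
  have PF : ProperFilter (within (I `*` @sphere3 R) (nbhs (t, q))).
    by apply: within_nbhs_proper; exact: subset_closure.
  suff : (fun tq : R * S => extend (fun p => H (tq.1, p)) tq.2) @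
      within (I `*` @sphere3 R) (nbhs (t, q)) --> ((0, 0, 0, 1) : S).
    by rewrite -qN.
  apply: (@cvg_north _ _ _ _ (fun tq => C * (1 - tq.2.2))).
    rewrite [X in _ --> X](_ : _ = C * (1 - 1)); last by rewrite subrr mulr0.
    apply: (cvgM (@cvg_cst R C _ _ _)); apply: (cvgB (@cvg_cst R 1 _ _ _)).
    by rewrite -q1; exact: cvg_within_filter.
  apply: filterS (withinT _ _) => -[t' q'] [/= tI' qS'].
  by split; [exact: extend_sphere|apply: extend_last => //; exact: HC].
apply: cvg_within_filter.
have q1' : \forall tq \near (t, q), tq.2.2 != 1.
  have c3 : (fun tq : R * S => 1 - tq.2.2) @ nbhs (t, q) --> 1 - q.2.
    by apply: (cvgB (@cvg_cst R 1 _ _ _)).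
  have q0 : 1 - q.2 != 0 by rewrite subr_eq0 eq_sym.
  by apply: filterS (cvgr_neq0 _ c3 q0) => x; rewrite subr_eq0 eq_sym.
suff : (fun tq : R * S => extend (fun p => H (tq.1, p)) tq.2) @ nbhs (t, q)
    --> to_sphere3 (H (t, from_sphere3 q)).
  have <- // :
    extend (fun p => H (t, p)) q = to_sphere3 (H (t, from_sphere3 q)).
  by rewrite /extend (negbTE q1).
apply: (@cvg_trans _ ((fun tq : R * S =>
    to_sphere3 (H (tq.1, from_sphere3 tq.2))) @ nbhs (t, q))).
  apply: near_eq_cvg; apply: filterS q1' => x x1.
  by rewrite /extend (negbTE x1).
apply: (@cvg_comp _ _ _ (fun tq : R * S => H (tq.1, from_sphere3 tq.2))
   (@to_sphere3 R)); last exact: to_sphere3_continuous.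
apply: (@cvg_comp _ _ _ (fun tq : R * S => (tq.1, from_sphere3 tq.2)) H);
  last exact: Hc.
have cf : (fun tq : R * S => from_sphere3 tq.2) @ nbhs (t, q) -->
    from_sphere3 q.
  apply: (@cvg_comp _ _ _ snd from_sphere3); first exact: cvg_snd.
  exact: from_sphere3_continuous.
exact: (cvg_pair cvg_fst cf).
Qed.

(** The isotopy runs from the image back to the set, so that transitivity alone
turns a homeomorphism onto the cube diagram into an isotopy from this diagram
to the plane one, and then on to the knot. *)
Definition tame (h : V -> V) : Prop := forall P : set V,
  ambient_isotopic (@to_sphere3 R @` (h @` P)) (@to_sphere3 R @` P).

Lemma tame_comp g h : tame g -> tame h -> tame (g \o h).
Proof.
move=> gT hT P; apply: (ambient_isotopic_trans _ _ (hT P)).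
  by move=> _ [p _ <-]; exact: to_sphere3_sphere.
by rewrite -[(g \o h) @` P]image_comp; exact: gT.
Qed.

Lemma isotopy_tame (H : R * V -> V) (G : R -> V -> V) (C : R) (h : V -> V) :
  continuous H -> (forall p, H (0, p) = p) -> (forall p, H (1, h p) = p) ->
  (forall t, 0 <= t <= 1 ->
    [/\ continuous (G t), cancel (fun p => H (t, p)) (G t)
      & cancel (G t) (fun p => H (t, p))]) ->
  (forall t, 0 <= t <= 1 -> forall p,
    sqnorm p + 1 <= C * (sqnorm (H (t, p)) + 1)) ->
  (forall t, 0 <= t <= 1 -> forall p,
    sqnorm p + 1 <= C * (sqnorm (G t p) + 1)) ->
  tame h.
Proof.
move=> Hc H0 H1 GH HC GC P.
exists (fun tq => extend (fun p => H (tq.1, p)) tq.2); split.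
- apply: (extend_continuous Hc (C := C)) => t /=; rewrite in_itv /=; exact: HC.
- move=> t /=; rewrite in_itv /= => t01; have [Gc HK GK] := GH _ t01.
  have cont (K : V -> V) : continuous K ->
      (forall p, sqnorm p + 1 <= C * (sqnorm (K p) + 1)) ->
      {within @sphere3 R, continuous (extend K)}.
    move=> Kc KC.
    have Kc' : continuous (K \o snd : R * V -> V).
      by move=> p; apply: (@cvg_comp _ _ _ snd K); [exact: cvg_snd|exact: Kc].
    have E := @extend_continuous (K \o snd) setT C Kc' (fun _ _ => KC).
    have p0 : {within @sphere3 R, continuous (pair (0 : R))}.
      apply: continuous_subspaceT => q.
      exact: (cvg_pair (@cvg_cst R 0 _ _ _) cvg_id).
    by apply: (within_continuous_comp _ p0 E) => q qS.
  exists (extend (G t)); split.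
  + split; last by apply: cont => //; exact: GC.
    apply: cont; last exact: HC.
    move=> p; apply: (@cvg_comp _ _ _ (pair t) H); last exact: Hc.
    exact: (cvg_pair (@cvg_cst R t _ _ _) cvg_id).
  + by split=> q; exact: extend_sphere.
  + by move=> q qS; rewrite extendK.
  + by move=> q qS /=; rewrite (extendK (h := G t) (g := fun p => H (t, p))).
- move=> q qS; rewrite /extend /=; case: ifP => // /negbT q1.
  by rewrite H0 from_sphere3K.
- apply/seteqP; split=> q.
    move=> [_ [_ [p pP <-] <-] <-]; exists p => //=.
    by rewrite extend_to_sphere3 /= H1.
  move=> [p pP <-]; exists (to_sphere3 (h p)).
    by exists (h p) => //; exists p.
  by rewrite extend_to_sphere3 /= H1.
Qed.

Definition slide (e : V) (a : R) p : V :=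
  (p.1.1 + a * e.1.1, p.1.2 + a * e.1.2, p.2 + a * e.2).

Lemma slideK e a p : slide e (- a) (slide e a p) = p.
Proof. by case: p => [[x y] z]; congr (_, _, _) => /=; ring. Qed.

Lemma slide0 e p : slide e 0 p = p.
Proof. by case: p => [[x y] z]; congr (_, _, _) => /=; ring. Qed.

Lemma slide_continuous (T : topologicalType) e (a : T -> R) (f : T -> V) :
  continuous a -> continuous f -> continuous (fun t => slide e (a t) (f t)).
Proof.
move=> ac fc t.
have c1 : (fun t => (f t).1.1) @ t --> (f t).1.1.
  apply: (@cvg_comp _ _ _ f (fun p => p.1.1)); first exact: fc.
  by apply: (@cvg_comp _ _ _ fst fst); exact: cvg_fst.
have c2 : (fun t => (f t).1.2) @ t --> (f t).1.2.
  apply: (@cvg_comp _ _ _ f (fun p => p.1.2)); first exact: fc.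
  by apply: (@cvg_comp _ _ _ fst snd); [exact: cvg_fst|exact: cvg_snd].
have c3 : (fun t => (f t).2) @ t --> (f t).2.
  by apply: (@cvg_comp _ _ _ f snd); [exact: fc|exact: cvg_snd].
have ca (b : R) : (fun t => a t * b) @ t --> a t * b.
  exact: (cvgM (ac t) (@cvg_cst R b _ _ _)).
exact: (cvg_pair (cvg_pair (cvgD c1 (ca _)) (cvgD c2 (ca _))) (cvgD c3 (ca _))).
Qed.

Lemma slide_sqnorm e a p k : a ^+ 2 <= k * (sqnorm p + 1) ->
  sqnorm (slide e a p) + 1 <= (2 + 2 * k * sqnorm e) * (sqnorm p + 1).
Proof.
case: p => [[x y] z]; case: e => [[e1 e2] e3] /= h.
have h1 (u v : R) : (u + v) ^+ 2 <= 2 * u ^+ 2 + 2 * v ^+ 2.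
  by have := sqr_ge0 (u - v); nra.
have := h1 x (a * e1); have := h1 y (a * e2); have := h1 z (a * e3).
rewrite !exprMn.
have : a ^+ 2 * (e1 ^+ 2 + e2 ^+ 2 + e3 ^+ 2) <=
   k * (x ^+ 2 + y ^+ 2 + z ^+ 2 + 1) * (e1 ^+ 2 + e2 ^+ 2 + e3 ^+ 2).
  by rewrite ler_wpM2r// !addr_ge0// sqr_ge0.
have := sqr_ge0 x; have := sqr_ge0 y; have := sqr_ge0 z.
lra.
Qed.

(** Along the lines of direction [e] the isotopy is the straight-line motion
from the identity to p |-> slide e (f p) p, and [g t] is the displacement that
undoes it at time t. A point is recovered from its image by the displacement [g
t], so that the growth of the displacements bounds both the motion and its
inverse. *)
Lemma line_tame e (f : V -> R) (g : R -> V -> R) (k : R) :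
  continuous f ->
  (forall t, 0 <= t <= 1 -> continuous (g t)) ->
  (forall t, 0 <= t <= 1 -> forall p, g t (slide e (t * f p) p) = t * f p) ->
  (forall t, 0 <= t <= 1 -> forall p, t * f (slide e (- g t p) p) = g t p) ->
  (forall p, f p ^+ 2 <= k * (sqnorm p + 1)) ->
  (forall t, 0 <= t <= 1 -> forall p, g t p ^+ 2 <= k * (sqnorm p + 1)) ->
  tame (fun p => slide e (- g 1 p) p).
Proof.
move=> fc gc gK fK fk gk.
pose H tp := slide e (tp.1 * f tp.2) tp.2.
have HG t : 0 <= t <= 1 -> cancel (fun p => slide e (- g t p) p)
     (fun p => H (t, p)).
  by move=> t01 p; rewrite /H /= fK// -{1}[g t p]opprK slideK.
have GH t : 0 <= t <= 1 -> cancel (fun p => H (t, p))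
    (fun p => slide e (- g t p) p).
  by move=> t01 p; rewrite /H /= gK// slideK.
apply: (@isotopy_tame H (fun t p => slide e (- g t p) p)
    (2 + 2 * k * sqnorm e)).
- apply: slide_continuous; last by move=> ?; exact: cvg_snd.
  move=> tp; apply: (cvgM cvg_fst).
  by apply: (@cvg_comp _ _ _ snd f); [exact: cvg_snd|exact: fc].
- by move=> p; rewrite /H /= mul0r slide0.
- by move=> p; apply: HG; rewrite ler01 lexx.
- move=> t t01; split; [|exact: GH|exact: HG].
  apply: slide_continuous; last by move=> ?; exact: cvg_id.
  by move=> p; apply: cvgN; exact: gc.
- move=> t t01 p; rewrite -{1}[p](GH _ t01).
  by apply: slide_sqnorm; rewrite sqrrN; exact: gk.
- move=> t t01 p; rewrite -{1}[p](HG _ t01).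
  apply: slide_sqnorm; apply: le_trans (fk _); rewrite exprMn.
  by have [t0 t1] := andP t01; rewrite ler_piMl ?sqr_ge0// expr_le1.
Qed.

(** As [f] is constant along [e], the shear by [- f] is the inverse. *)
Lemma shear_tame e (f : V -> R) (k : R) :
  continuous f -> (forall a p, f (slide e a p) = f p) ->
  (forall p, f p ^+ 2 <= k * (sqnorm p + 1)) ->
  tame (fun p => slide e (f p) p).
Proof.
move=> fc fe fk.
rewrite (_ : (fun p => _) = (fun p => slide e (- (1 * - f p)) p)); last first.
  by apply/funext => p; rewrite mul1r opprK.
apply: (@line_tame e (fun p => - f p) (fun t p => t * - f p) k).
- by move=> p; apply: cvgN; exact: fc.
- move=> t _ p; apply: (cvgM (@cvg_cst R t _ _ _)).
  by apply: cvgN; exact: fc.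
- by move=> t _ p; rewrite fe.
- by move=> t _ p; rewrite fe.
- by move=> p; rewrite sqrrN.
- move=> t t01 p; apply: le_trans (fk p); rewrite exprMn sqrrN.
  by have [t0 t1] := andP t01; rewrite ler_piMl ?sqr_ge0// expr_le1.
Qed.

End Stereographic.

(** * Folding the plane around a vertex of the cube *)

Section Fold.
Variable R : realType.
Notation V := (R * R * R)%type.
Implicit Types (p : V) (a b x y z h s t : R).

Definition pos a : R := Num.max a 0.

Lemma pos_id a : 0 <= a -> pos a = a. Proof. exact: max_l. Qed.
Lemma pos_0 a : a <= 0 -> pos a = 0. Proof. exact: max_r. Qed.
Lemma pos_ge0 a : 0 <= pos a. Proof. by rewrite /pos le_max lexx orbT. Qed.
Lemma pos_sqr a : pos a ^+ 2 <= a ^+ 2.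
Proof.
by have [/pos_id->//|/ltW/pos_0->] := leP 0 a; rewrite expr0n sqr_ge0.
Qed.

(** The map y |-> y + bump A y is piecewise linear with breaks at - A, 0 and 2
* A; it takes 0 to A and is the identity outside of these breaks. *)
Definition bump A y : R := pos (Num.min (y + A) (A - y / 2)).
(** The displacement that undoes y |-> y + t * bump A y. *)
Definition unbump t A y : R :=
  pos (Num.min (t / (1 + t) * (y + A)) (t / (1 - t / 2) * (A - y / 2))).

(** The two linear pieces of the bump cross at y = 0, and those of [unbump] at
the image t * A of this point, so that corresponding pieces are active. *)
Lemma unbumpK t A y : 0 <= t <= 1 ->
  unbump t A (y + t * bump A y) = t * bump A y.
Proof.
move=> /andP[t0 t1]; rewrite /unbump /bump.
have t1' : 0 < 1 + t by lra.
have t2' : 0 < 1 - t / 2 by lra.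
have t1n : 1 + t != 0 by rewrite gt_eqF.
have t2n : 2 - t != 0 by rewrite gt_eqF//; lra.
have c1 : 0 <= t / (1 + t) by rewrite divr_ge0// ltW.
have c2 : 0 <= t / (1 - t / 2) by rewrite divr_ge0// ltW.
have [h|h] := leP (Num.min (y + A) (A - y / 2)) 0.
  rewrite (pos_0 h) mulr0 addr0; apply: pos_0; rewrite ge_min.
  by move: h; rewrite ge_min => /orP[h|h]; apply/orP; [left|right];
    exact: mulr_ge0_le0.
rewrite (pos_id (ltW h)); move: h.
have [le1|/ltW le1] := leP (y + A) (A - y / 2) => h.
  rewrite min_l; last first.
    rewrite -subr_ge0 (_ : _ - _ = t / (1 - t / 2) * (A - y / 2 - (y + A))).
      by rewrite mulr_ge0// subr_ge0.
    by field; rewrite t1n t2n.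
  have -> : t / (1 + t) * (y + t * (y + A) + A) = t * (y + A) by field.
  by apply: pos_id; rewrite mulr_ge0// ltW.
rewrite min_r; last first.
  rewrite -subr_ge0 (_ : _ - _ = t / (1 + t) * (y + A - (A - y / 2))).
    by rewrite mulr_ge0// subr_ge0.
  by field; rewrite t1n t2n.
have -> : t / (1 - t / 2) * (A - (y + t * (A - y / 2)) / 2) = t * (A - y / 2).
  by field; rewrite t2n.
by apply: pos_id; rewrite mulr_ge0// ltW.
Qed.

Lemma bumpK t A y : 0 <= t <= 1 -> t * bump A (y - unbump t A y) = unbump t A y.
Proof.
move=> /andP[t0 t1]; rewrite /unbump /bump.
have t1' : 0 < 1 + t by lra.
have t2' : 0 < 1 - t / 2 by lra.
have t1n : 1 + t != 0 by rewrite gt_eqF.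
have t2n : 2 - t != 0 by rewrite gt_eqF//; lra.
have c1 : 0 <= t / (1 + t) by rewrite divr_ge0// ltW.
have c2 : 0 <= t / (1 - t / 2) by rewrite divr_ge0// ltW.
have [->|tn0] := eqVneq t 0; first by rewrite !mul0r minxx /pos maxxx.
have tp : 0 < t by rewrite lt_neqAle eq_sym tn0.
set u := t / (1 + t) * (y + A); set v := t / (1 - t / 2) * (A - y / 2).
set m := Num.min u v; have [h|h] := leP m 0.
  rewrite (pos_0 h) subr0 pos_0 ?mulr0//; rewrite ge_min.
  by move: h; rewrite ge_min !pmulr_rle0// ?divr_gt0.
rewrite (pos_id (ltW h)).
suff -> : Num.min (y - m + A) (A - (y - m) / 2) = m / t.
  by rewrite pos_id ?divr_ge0// ?ltW//; field.
move: h; rewrite {}/m.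
have uE : y = u * (1 + t) / t - A by rewrite /u; field; rewrite tn0 t1n.
have vE : y = 2 * (A - v * (1 - t / 2) / t).
  by rewrite /v; field; rewrite tn0 t2n.
have [le1|/ltW le1] := leP u v => h.
  have e : y - u + A = u / t by rewrite uE; field.
  rewrite e min_l//.
  have -> : A - (y - u) / 2 = (v - u) * (1 - t / 2) / t + u / t.
    by rewrite vE; field.
  have uv : 0 <= v - u by rewrite subr_ge0.
  by rewrite lerDr divr_ge0// mulr_ge0// ltW.
have e : A - (y - v) / 2 = v / t by rewrite vE; field.
rewrite e min_r//.
have -> : y - v + A = (u - v) * (1 + t) / t + v / t by rewrite uE; field.
have uv : 0 <= u - v by rewrite subr_ge0.
by rewrite lerDr divr_ge0// mulr_ge0// ltW.
Qed.

Lemma bump_bounds A y : 0 <= A -> 0 <= bump A y <= A.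
Proof.
move=> A0; rewrite /bump pos_ge0 /= /pos ge_max A0 andbT ge_min.
by have [y0|y0] := leP y 0; apply/orP; [left|right]; lra.
Qed.

Lemma unbump_out t A y : 0 <= t <= 1 -> (y + A <= 0) || (2 * A <= y) ->
  unbump t A y = 0.
Proof.
move=> /andP[t0 t1] h; apply: pos_0; rewrite ge_min.
have c1 : 0 <= t / (1 + t) by rewrite divr_ge0//; lra.
have c2 : 0 <= t / (1 - t / 2) by rewrite divr_ge0//; lra.
by case/orP: h => h; apply/orP; [left|right]; apply: mulr_ge0_le0 => //; lra.
Qed.

Lemma unbump_peak A : 0 <= A -> unbump 1 A A = A.
Proof.
move=> A0; rewrite /unbump.
have -> : 1 / (1 + 1) * (A + A) = A :> R by field.
have -> : 1 / (1 - 1 / 2) * (A - A / 2) = A :> R by field.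
by rewrite minxx pos_id.
Qed.

(** Naming the property fixes the topology on the domain, so that proofs of
continuity can be written as terms that follow the formulas. *)
Definition creal (f : V -> R) : Prop := continuous f.

Section Continuity.
Implicit Types f g : V -> R.

Lemma creal_x : creal (fun p => p.1.1).
Proof. by move=> p; apply: (@cvg_comp _ _ _ fst fst); exact: cvg_fst. Qed.
Lemma creal_y : creal (fun p => p.1.2).
Proof.
by move=> p; apply: (@cvg_comp _ _ _ fst snd); [exact: cvg_fst|exact: cvg_snd].
Qed.
Lemma creal_z : creal (fun p => p.2).
Proof. by move=> p; exact: cvg_snd. Qed.
Lemma creal_cst a : creal (fun _ => a).
Proof. by move=> p; exact: cvg_cst. Qed.
Lemma creal_add f g : creal f -> creal g -> creal (fun p => f p + g p).
Proof. by move=> fc gc p; exact: (cvgD (fc p) (gc p)). Qed.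
Lemma creal_opp f : creal f -> creal (fun p => - f p).
Proof. by move=> fc p; exact: (cvgN (fc p)). Qed.
Lemma creal_mul f g : creal f -> creal g -> creal (fun p => f p * g p).
Proof. by move=> fc gc p; exact: (cvgM (fc p) (gc p)). Qed.
Lemma creal_max f g : creal f -> creal g ->
  creal (fun p => Num.max (f p) (g p)).
Proof. by move=> fc gc p; exact: (continuous_max (fc p) (gc p)). Qed.
Lemma creal_min f g : creal f -> creal g ->
  creal (fun p => Num.min (f p) (g p)).
Proof. by move=> fc gc p; exact: (continuous_min (fc p) (gc p)). Qed.
Lemma creal_pos f : creal f -> creal (fun p => pos (f p)).
Proof. by move=> fc; apply: creal_max => //; exact: creal_cst. Qed.
End Continuity.

Lemma sqnorm_coords p : [/\ p.1.1 ^+ 2 <= sqnorm p, p.1.2 ^+ 2 <= sqnorm p &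
  p.2 ^+ 2 <= sqnorm p].
Proof.
case: p => [[x y] z] /=; have := sqr_ge0 x; have := sqr_ge0 y.
by have := sqr_ge0 z; split; lra.
Qed.

Lemma translation_tame (e : V) : tame (slide e 1).
Proof.
apply: (@shear_tame R e (fun _ => 1) 1) => //; first exact: creal_cst.
by move=> p; rewrite expr1n mul1r lerDr sqnorm_ge0.
Qed.

(** The origin is the vertex of the cube, to which the corner of the three
quadrants has been translated. The upper half-plane and the left half-plane are
bent down by 45 degrees. *)
Definition bend p := slide (0, 0, 1) (- (pos p.1.2 + pos (- p.1.1))) p.
(** Moves the lower left quadrant onto the plane x = 0, with its over-strands
on the side x < 0. The term in y keeps the upper right quadrant fixed and lets
the arc of the corner square go to this plane as well. *)
Definition tuck p := slide (1, 0, 0) (pos (- p.2 - pos p.1.2)) p.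
(** The over-strands of the lower left face now point to the side x < 0; their
height is taken off the third coordinate. *)
Definition turn p := slide (0, 0, 1) (- pos (- p.1.1)) p.
(** Takes the upper right quadrant down to the plane y = 0. Near the gluing
edge x = 0 the slope [K] replaces a jump. *)
Definition lower (K : R) p :=
  slide (0, 1, 0) (- Num.min (pos (- p.2)) (K * pos p.1.1)) p.
(** Together with [bend] and [lower] this is a rotation by 90 degrees on the
upper right quadrant, as a product of three shears. *)
Definition straighten p := slide (0, 0, 1) (- pos p.1.2) p.

(** Consider the triangle with vertices (0, 0, - 1 / 2), (0, 1 / 2, - 1 / 2)
and (x0, 0, - 1 / 2 + eps * x0), whose base is the side in the plane y = 0.
Projected to the base along (- x0, 1, - (eps * x0)), its two other sides are
the graph of y = min (X, 1 - X), where X = (x + x0 * y) / x0 is the parameter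
of the base. The last term cuts the tent off towards the face z = 0. *)
Definition tent (x0 eps : R) p : R :=
  pos (Num.min
    (Num.min ((p.1.1 + x0 * p.1.2) / x0) (1 - (p.1.1 + x0 * p.1.2) / x0))
    (- 2 * (p.2 + eps * x0 * p.1.2))).
(** Pushes the two other sides of the triangle of [tent] onto its base. *)
Definition flatten (x0 eps : R) p :=
  slide (- x0, 1, - (eps * x0)) (- unbump 1 (tent x0 eps p) p.1.2) p.

Lemma sqrD2 a b : (a + b) ^+ 2 <= 2 * a ^+ 2 + 2 * b ^+ 2.
Proof. by have := sqr_ge0 (a - b); nra. Qed.

Lemma bend_tame : tame bend.
Proof.
apply: (@shear_tame R _ (fun p => - (pos p.1.2 + pos (- p.1.1))) 4).
- exact: (creal_opp (creal_add (creal_pos creal_y)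
    (creal_pos (creal_opp creal_x)))).
- by move=> a p /=; rewrite mulr0 !addr0.
- move=> p; rewrite sqrrN; have [x2 y2 z2] := sqnorm_coords p.
  apply: le_trans (sqrD2 _ _) _.
  by have := pos_sqr p.1.2; have := pos_sqr (- p.1.1); rewrite sqrrN; lra.
Qed.

Lemma tuck_tame : tame tuck.
Proof.
apply: (@shear_tame R _ (fun p => pos (- p.2 - pos p.1.2)) 4).
- exact: (creal_pos (creal_add (creal_opp creal_z)
    (creal_opp (creal_pos creal_y)))).
- by move=> a p /=; rewrite mulr0 !addr0.
- move=> p; have [x2 y2 z2] := sqnorm_coords p.
  apply: le_trans (pos_sqr _) _; apply: le_trans (sqrD2 _ _) _.
  by rewrite !sqrrN; have := pos_sqr p.1.2; lra.
Qed.

Lemma turn_tame : tame turn.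
Proof.
apply: (@shear_tame R _ (fun p => - pos (- p.1.1)) 1).
- exact: (creal_opp (creal_pos (creal_opp creal_x))).
- by move=> a p /=; rewrite mulr0 !addr0.
- move=> p; have [x2 y2 z2] := sqnorm_coords p.
  by rewrite sqrrN; have := pos_sqr (- p.1.1); rewrite sqrrN; lra.
Qed.

Lemma straighten_tame : tame straighten.
Proof.
apply: (@shear_tame R _ (fun p => - pos p.1.2) 1).
- exact: (creal_opp (creal_pos creal_y)).
- by move=> a p /=; rewrite mulr0 !addr0.
- move=> p; have [x2 y2 z2] := sqnorm_coords p.
  by rewrite sqrrN; have := pos_sqr (p.1.2); lra.
Qed.

Lemma lower_tame (K : R) : 0 <= K -> tame (lower K).
Proof.
move=> K0.
apply: (@shear_tame R _ (fun p => - Num.min (pos (- p.2)) (K * pos p.1.1)) 1).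
- exact: (creal_opp (creal_min (creal_pos (creal_opp creal_z))
    (creal_mul (@creal_cst K) (creal_pos creal_x)))).
- by move=> a p /=; rewrite mulr0 !addr0.
- move=> p; have [x2 y2 z2] := sqnorm_coords p; rewrite sqrrN.
  have m0 : 0 <= Num.min (pos (- p.2)) (K * pos p.1.1).
    by rewrite le_min pos_ge0 mulr_ge0// pos_ge0.
  have : Num.min (pos (- p.2)) (K * pos p.1.1) ^+ 2 <= pos (- p.2) ^+ 2.
    by rewrite lerXn2r// ?nnegrE ?pos_ge0// ge_min lexx.
  by have := pos_sqr (- p.2); rewrite sqrrN; lra.
Qed.

Lemma tent_bounds x0 eps p : 0 <= tent x0 eps p <= 1 / 2.
Proof.
rewrite /tent pos_ge0 /= /pos ge_max; apply/andP; split; last by lra.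
rewrite !ge_min; set X := _ / x0.
have [h|h] := leP X (1 / 2); first by apply/orP; left; apply/orP; left.
by apply/orP; left; apply/orP; right; lra.
Qed.

Lemma flatten_tame x0 eps : x0 != 0 -> tame (flatten x0 eps).
Proof.
move=> x00; set e : V := (- x0, 1, - (eps * x0)).
have tentE a p : tent x0 eps (slide e a p) = tent x0 eps p.
  rewrite /tent /=; congr (pos (Num.min (Num.min _ (1 - _)) _)).
  - by field.
  - by field.
  - by ring.
have bound t p q : 0 <= t <= 1 ->
    (t * bump (tent x0 eps p) q) ^+ 2 <= 1 * (sqnorm p + 1).
  move=> /andP[t0 t1]; have /andP[A0 A1] := tent_bounds x0 eps p.
  have /andP[b0 b1] := bump_bounds q A0.
  rewrite mul1r; apply: le_trans (_ : 1 <= _); last by rewrite lerDr sqnorm_ge0.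
  by rewrite exprn_ile1// ?mulr_ge0// mulr_ile1//; lra.
have tentC : creal (tent x0 eps).
  have X := creal_mul (creal_add creal_x (creal_mul (@creal_cst x0) creal_y))
    (@creal_cst x0^-1).
  exact: (creal_pos (creal_min
    (creal_min X (creal_add (@creal_cst 1) (creal_opp X)))
    (creal_mul (@creal_cst (- 2)) (creal_add creal_z
       (creal_mul (@creal_cst (eps * x0)) creal_y))))).
have H := @line_tame R e (fun p => bump (tent x0 eps p) p.1.2)
  (fun t p => unbump t (tent x0 eps p) p.1.2) 1.
apply: H.
- exact: (creal_pos (creal_min (creal_add creal_y tentC)
    (creal_add tentC (creal_opp (creal_mul creal_y (@creal_cst 2^-1)))))).
- move=> t _.
  exact: (creal_pos (creal_min
    (creal_mul (@creal_cst (t / (1 + t))) (creal_add creal_y tentC))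
    (creal_mul (@creal_cst (t / (1 - t / 2)))
       (creal_add tentC (creal_opp (creal_mul creal_y (@creal_cst 2^-1))))))).
- by move=> t t01 p; rewrite tentE /= mulr1 unbumpK.
- by move=> t t01 p; rewrite tentE /= mulr1 bumpK.
- move=> p; have := bound 1 p p.1.2.
  by rewrite mul1r => ->//; rewrite ler01 lexx.
- by move=> t t01 p; rewrite -bumpK//; exact: bound.
Qed.

Variables (K x0 eps : R).
Hypothesis K3 : 3 <= K.
Hypothesis eps01 : 0 <= eps <= 1.
Hypothesis x0E : (K + eps) * x0 = 1 / 2.

Let x0_gt0 : 0 < x0.
Proof.
have K3' := K3.
have Kp : 0 < K + eps by case/andP: eps01 => *; lra.
by rewrite -(pmulr_rgt0 _ Kp) x0E; lra.
Qed.

Let x0_le : x0 <= 1 / 6.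
Proof.
have K3' := K3.
have : 3 * x0 <= (K + eps) * x0.
  by rewrite ler_pM2r//; case/andP: eps01 => *; lra.
by rewrite x0E; lra.
Qed.

Definition fold p : V :=
  straighten (flatten x0 eps (lower K (turn (tuck (bend p))))).

Lemma fold_tame : tame fold.
Proof.
have K0 : 0 <= K := le_trans (ler0n _ 3) K3.
have x00 : x0 != 0 by rewrite gt_eqF.
exact: (tame_comp straighten_tame (tame_comp (flatten_tame eps x00)
  (tame_comp (lower_tame K0) (tame_comp turn_tame
    (tame_comp tuck_tame bend_tame))))).
Qed.

Lemma bendE x y z : bend (x, y, z) = (x, y, z - pos y - pos (- x)).
Proof. by rewrite /bend /slide /=; congr (_, _, _); ring. Qed.
Lemma tuckE x y z : tuck (x, y, z) = (x + pos (- z - pos y), y, z).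
Proof. by rewrite /tuck /slide /=; congr (_, _, _); ring. Qed.
Lemma turnE x y z : turn (x, y, z) = (x, y, z - pos (- x)).
Proof. by rewrite /turn /slide /=; congr (_, _, _); ring. Qed.
Lemma lowerE x y z :
  lower K (x, y, z) = (x, y - Num.min (pos (- z)) (K * pos x), z).
Proof. by rewrite /lower /slide /=; congr (_, _, _); ring. Qed.
Lemma straightenE x y z : straighten (x, y, z) = (x, y, z - pos y).
Proof. by rewrite /straighten /slide /=; congr (_, _, _); ring. Qed.

Lemma flatten_out x y z :
  let A := tent x0 eps (x, y, z) in (y + A <= 0) || (2 * A <= y) ->
  flatten x0 eps (x, y, z) = (x, y, z).
Proof.
move=> A h; rewrite /flatten unbump_out ?lexx ?ler01//.
by rewrite oppr0 slide0.
Qed.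

Lemma flatten_peak x y z : tent x0 eps (x, y, z) = y ->
  flatten x0 eps (x, y, z) = (x + x0 * y, 0, z + eps * x0 * y).
Proof.
move=> h; rewrite /flatten h unbump_peak; last first.
  by rewrite -h; case/andP: (tent_bounds x0 eps (x, y, z)).
by rewrite /slide /=; congr (_, _, _); ring.
Qed.

Lemma tent_out x y z : (x + x0 * y <= 0) || (x0 <= x + x0 * y) ->
  tent x0 eps (x, y, z) = 0.
Proof.
move=> h; apply: pos_0; rewrite !ge_min /=.
case/orP: h => h.
  by apply/orP; left; apply/orP; left; rewrite pmulr_lle0// invr_gt0.
by apply/orP; left; apply/orP; right; rewrite subr_le0 ler_pdivlMr// mul1r.
Qed.

(** For this and the next two lemmas, [h] is the height over the tile. The
bounds on it hold since over-strands stay below their distance to the fold. *)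
Lemma fold_right_down x y h : 0 <= x -> y <= 0 -> 0 <= h ->
  fold (x, y, h) = (x, y, h).
Proof.
have [K3' xp xl] : [/\ 3 <= K, 0 < x0 & x0 <= 1 / 6] by split.
move=> x_ge0 yle hge; case/andP: eps01 => e0 e1.
have Nx : - x <= 0 by lra.
have Nh : - h <= 0 by lra.
rewrite /fold bendE (pos_0 yle) (pos_0 Nx) !subr0 tuckE (pos_0 yle) subr0.
rewrite (pos_0 Nh) addr0 turnE (pos_0 Nx) subr0 lowerE (pos_0 Nh).
rewrite min_l; last first.
  by rewrite mulr_ge0 ?pos_ge0//; lra.
rewrite subr0 flatten_out ?straightenE ?(pos_0 yle) ?subr0//.
apply/orP; left.
have [c|c] := leP 0 (y + tent x0 eps (x, y, h)); last exact: ltW.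
(* For y < 0 the cut-off term may be positive, but it is at most - y. *)
suff : tent x0 eps (x, y, h) <= - y by lra.
rewrite /tent /pos ge_max !ge_min /=; apply/andP; split; last by lra.
apply/orP; right.
have : eps * x0 <= 1 / 6 by nra.
have : 0 <= eps * x0 by rewrite mulr_ge0// ltW.
by move=> *; nra.
Qed.

Lemma fold_left_down x y h : y <= 0 -> 0 <= h -> h <= - x ->
  fold (x, y, h) = (- h, y, x).
Proof.
have [K3' xp xl] : [/\ 3 <= K, 0 < x0 & x0 <= 1 / 6] by split.
move=> yle hge hx.
have Nx : 0 <= - x by lra.
have Nh : - h <= 0 by lra.
rewrite /fold bendE (pos_0 yle) (pos_id Nx) subr0 opprK tuckE (pos_0 yle) subr0.
have zx : 0 <= - (h + x) by lra.
rewrite (pos_id zx) (_ : x + - (h + x) = - h); last by ring.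
rewrite turnE opprK (pos_id hge) (_ : h + x - h = x); last by ring.
rewrite lowerE (pos_0 Nh) mulr0 min_r ?pos_ge0// subr0 flatten_out.
  by rewrite straightenE (pos_0 yle) subr0.
rewrite tent_out; first by rewrite addr0 yle.
by apply/orP; left; nra.
Qed.

(** The upper right quadrant, except for the squares of the first column that
the curve enters from the left. *)
Lemma fold_right_up x y h : 1 / 2 <= x -> 0 <= h -> h <= y -> y <= K / 2 ->
  fold (x, y, h) = (x, h, - y).
Proof.
have [K3' xp xl] : [/\ 3 <= K, 0 < x0 & x0 <= 1 / 6] by split.
move=> xge hge hy yK.
have x_ge0 : 0 <= x by lra.
have Nx : - x <= 0 by lra.
have y0 : 0 <= y by lra.
have Nh : - h <= 0 by lra.
have zy : 0 <= - (h - y) by lra.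
rewrite /fold bendE (pos_id y0) (pos_0 Nx) subr0 tuckE (pos_id y0).
rewrite (_ : - (h - y) - y = - h); last by ring.
rewrite (pos_0 Nh) addr0 turnE (pos_0 Nx) subr0 lowerE.
rewrite (pos_id zy) (pos_id x_ge0) min_l; last by nra.
rewrite (_ : y - - (h - y) = h); last by ring.
rewrite flatten_out.
  by rewrite straightenE (pos_id hge); congr (_, _, _); ring.
rewrite tent_out ?mulr0 ?hge ?orbT//.
by apply/orP; right; nra.
Qed.

(** The arc of the corner square goes to the left half of the base of the
triangle, parametrised here by the height of its points over the vertex. *)
Lemma fold_corner y : 0 <= y <= 1 / 2 ->
  fold (y - 1 / 2, y, 0) = (x0 * y, 0, - (1 / 2) + eps * (x0 * y)).
Proof.
have [K3' xp xl] : [/\ 3 <= K, 0 < x0 & x0 <= 1 / 6] by split.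
move=> /andP[y0 y1]; case/andP: eps01 => e0 e1.
have x1 : 0 <= - (y - 1 / 2) by lra.
rewrite /fold bendE (pos_id y0) (pos_id x1).
rewrite (_ : 0 - y - - (y - 1 / 2) = - (1 / 2)); last by ring.
rewrite tuckE (pos_id y0) opprK pos_id; last by lra.
rewrite (_ : y - 1 / 2 + (1 / 2 - y) = 0); last by ring.
have p00 : pos 0 = 0 by rewrite /pos maxxx.
rewrite turnE oppr0 p00 subr0 lowerE p00 mulr0 min_r ?pos_ge0// subr0.
rewrite flatten_peak.
  by rewrite straightenE p00 subr0 add0r; congr (_, _, _); ring.
rewrite /tent /=.
have -> : 0 + x0 * y = x0 * y by ring.
rewrite (_ : x0 * y / x0 = y); last by field; rewrite gt_eqF.
rewrite (min_l (x := y)); last by lra.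
rewrite min_l ?pos_id//.
have : eps * x0 <= 1 / 6 by nra.
have : 0 <= eps * x0 by rewrite mulr_ge0// ltW.
by move=> *; nra.
Qed.

(** The first bit of the chord on the right of the corner, the slanted side of
the triangle, goes to the right half of the base. The slope [eps] is 1 for a
chord to the lower side and 0 for a chord to the right side. *)
Lemma fold_chord_before s : 0 <= s -> s <= x0 ->
  fold (s, 1 / 2 - eps * s, 0) =
  ((x0 + s) / 2, 0, - (1 / 2) + eps * ((x0 + s) / 2)).
Proof.
have [K3' xp xl] : [/\ 3 <= K, 0 < x0 & x0 <= 1 / 6] by split.
move=> s0 sx; case/andP: eps01 => e0 e1.
have es : eps * s <= 1 / 6 by nra.
have es0 : 0 <= eps * s by rewrite mulr_ge0.
set b := 1 / 2 - eps * s.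
have b0 : 0 <= b by rewrite /b; lra.
have Ns : - s <= 0 by lra.
rewrite /fold bendE (pos_id b0) (pos_0 Ns) subr0 sub0r.
have p00 : pos 0 = 0 by rewrite /pos maxxx.
rewrite tuckE opprK (pos_id b0) subrr p00 addr0 turnE (pos_0 Ns) subr0.
have Kb : K * s <= b by rewrite /b; have := x0E; nra.
rewrite lowerE opprK (pos_id b0) (pos_id s0) min_r//.
have yE : b - K * s = 1 / 2 - s / x0 / 2.
  have -> : s / x0 / 2 = s * ((K + eps) * x0) / x0.
    by rewrite x0E; field; rewrite gt_eqF.
  by rewrite /b; field; rewrite gt_eqF.
have sx0 : 0 <= s / x0 <= 1.
  by rewrite divr_ge0 ?(ltW x0_gt0)//= ler_pdivrMr// mul1r.
case/andP: sx0 => sx0 sx1.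
rewrite flatten_peak.
  rewrite straightenE p00 subr0 yE; congr (_, _, _).
    by field; rewrite gt_eqF.
  by rewrite /b; field; rewrite gt_eqF.
rewrite /tent /= yE.
have -> : (s + x0 * (1 / 2 - s / x0 / 2)) / x0 = 1 / 2 + s / x0 / 2.
  by field; rewrite gt_eqF.
have -> : 1 - (1 / 2 + s / x0 / 2) = 1 / 2 - s / x0 / 2.
  by field; rewrite gt_eqF.
rewrite (min_r (y := 1 / 2 - s / x0 / 2)); last by lra.
rewrite min_l; first by apply: pos_id; lra.
have : eps * x0 <= 1 / 6 by nra.
have : 0 <= eps * x0 by rewrite mulr_ge0// ltW.
by rewrite /b => *; nra.
Qed.

Lemma fold_chord_after s : x0 <= s -> eps * s <= 1 / 2 ->
  fold (s, 1 / 2 - eps * s, 0) = (s, 0, - (1 / 2) + eps * s).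
Proof.
have [K3' xp xl] : [/\ 3 <= K, 0 < x0 & x0 <= 1 / 6] by split.
move=> sx es; case/andP: eps01 => e0 e1.
set b := 1 / 2 - eps * s.
have b0 : 0 <= b by rewrite /b; lra.
have s0 : 0 <= s by have := x0_gt0; lra.
have Ns : - s <= 0 by lra.
have p00 : pos 0 = 0 by rewrite /pos maxxx.
rewrite /fold bendE (pos_id b0) (pos_0 Ns) subr0 sub0r.
rewrite tuckE opprK (pos_id b0) subrr p00 addr0 turnE (pos_0 Ns) subr0.
have Kb : b <= K * s by rewrite /b; have := x0E; nra.
rewrite lowerE opprK (pos_id b0) (pos_id s0) min_l// subrr.
rewrite flatten_out.
  by rewrite straightenE p00 subr0 /b; congr (_, _, _); ring.
by rewrite tent_out ?mulr0 ?addr0 ?lexx ?orbT// sx orbT.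
Qed.

End Fold.

(** * The strands of a tile in the charts of a mosaic *)

Section TilePoints.
Variable R : realType.
Notation V := (R * R * R)%type.

Definition local_chart (u v h : R) : V := (u, v, h).

Definition tile_points (t : tile) : set V :=
  [set w | exists2 a, a \in arcs t & arc_lift local_chart a w].

Definition on_chart (c : R -> R -> R -> V) (w : V) : V := c w.1.1 w.1.2 w.2.

(** The charts of both kinds of mosaics are affine, so that chords and apexes
can be compared in the local coordinates of a tile. *)
Definition affine_chart (c : R -> R -> R -> V) : Prop :=
  forall (t : R) (p q : V), on_chart c ((1 - t) *: p + t *: q) =
    (1 - t) *: on_chart c p + t *: on_chart c q.

Lemma segment_image c p q : affine_chart c ->
  segment (on_chart c p) (on_chart c q) = on_chart c @` segment p q.
Proof.
move=> ca; apply/seteqP; split=> w.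
  by move=> [t t01 <-]; exists ((1 - t) *: p + t *: q); [exists t|exact: ca].
by move=> [_ [t t01 <-] <-]; exists t.
Qed.

Lemma arc_lift_image c a : affine_chart c ->
  arc_lift c a = on_chart c @` arc_lift local_chart a.
Proof.
move=> ca; case: a => [[s t] o]; rewrite /arc_lift.
case: (side_mid2 s) => xs ys; case: (side_mid2 t) => xt yt.
by rewrite image_setU -!segment_image.
Qed.

Lemma mosaic_liftE (Q : finType) (chart : Q -> R -> R -> R -> V)
    (M : Q -> tile) : (forall q, affine_chart (chart q)) ->
  mosaic_lift chart M =
  [set p | exists q w, tile_points (M q) w /\ p = on_chart (chart q) w].
Proof.
move=> ca; apply/seteqP; split=> p.
  move=> [q [a aM]]; rewrite arc_lift_image// => -[w wa <-].
  by exists q, w; split => //; exists a.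
move=> [q [w [[a aM wa] ->]]]; exists q; exists a => //.
by rewrite arc_lift_image//; exists w.
Qed.

Lemma plane_chart_affine n (q : 'I_n * 'I_n) :
  affine_chart (@plane_chart R n q).
Proof.
by move=> t [[a b] h] [[a' b'] h']; rewrite /on_chart /plane_chart /=;
  congr (_, _, _) => /=; rewrite /GRing.scale /=; ring.
Qed.

Lemma cube_chart_affine n (k : face * 'I_n * 'I_n) :
  affine_chart (@cube_chart R n k).
Proof.
case: k => [[f i] j].
by move=> t [[a b] h] [[a' b'] h']; case: f; rewrite /on_chart /cube_chart /=;
  congr (_, _, _) => /=; rewrite /GRing.scale /=; ring.
Qed.

Lemma segment_sym (p q : V) : segment p q = segment q p.
Proof.
suff sub (a b : V) : segment a b `<=` segment b a.
  by apply/seteqP; split; exact: sub.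
move=> w [t]; rewrite /= in_itv /= => /andP[t0 t1] <-; exists (1 - t).
  by rewrite /= in_itv /=; lra.
by rewrite subKr addrC.
Qed.

Lemma arc_lift_sym c s t o :
  arc_lift (R := R) c (s, t, o) = arc_lift c (t, s, o).
Proof.
rewrite /arc_lift; case: (side_mid2 s) => xs ys; case: (side_mid2 t) => xt yt.
rewrite setUC [in (xt + xs)%N]addnC [in (yt + ys)%N]addnC.
by congr (_ `|` _); rewrite segment_sym.
Qed.

Definition rot_point (w : V) : V := (1 - w.1.2, w.1.1, w.2).
Definition rot_chart (u v h : R) : V := (1 - v, u, h).
Definition rot_arc (a : side * side * bool) :=
  (rot_side a.1.1, rot_side a.1.2, a.2).
Definition flip_arc (a : side * side * bool) := (a.1.2, a.1.1, a.2).

Lemma rot_chart_affine : affine_chart rot_chart.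
Proof.
by move=> t [[a b] h] [[a' b'] h']; rewrite /on_chart /rot_chart /=;
  congr (_, _, _) => /=; rewrite /GRing.scale /=; ring.
Qed.

(** The quarter turn of the square [0, 1]^2 acts on sides as [rot_side]. *)
Lemma arc_lift_rot a :
  arc_lift local_chart (rot_arc a) = rot_point @` arc_lift local_chart a.
Proof.
rewrite (_ : rot_point = on_chart rot_chart)//.
rewrite -(arc_lift_image _ rot_chart_affine).
have half : (2%:R / 2 : R) = 1 by field.
by case: a => [[s t] o]; case: s; case: t; rewrite /arc_lift /rot_arc /=;
  congr (segment (_, _, _) (_, _, _) `|` segment (_, _, _) (_, _, _)); field.
Qed.

(** [rot_tile] turns the arcs, up to the order of their ends. *)
Lemma rot_arcs t : all (fun a => (rot_arc a \in arcs (rot_tile t)) ||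
  (flip_arc (rot_arc a) \in arcs (rot_tile t))) (arcs t).
Proof. by case: t. Qed.

Lemma unrot_arcs t : all (fun a => has (fun b => (a == rot_arc b) ||
  (a == flip_arc (rot_arc b))) (arcs t)) (arcs (rot_tile t)).
Proof. by case: t. Qed.

Lemma arc_lift_flip c a : arc_lift (R := R) c (flip_arc a) = arc_lift c a.
Proof. by case: a => [[s t] o]; exact: arc_lift_sym. Qed.

Lemma tile_points_rot t : tile_points (rot_tile t) = rot_point @` tile_points t.
Proof.
apply/seteqP; split=> w.
  move=> [a /(allP (unrot_arcs t))/hasP[b bt ab] wa].
  have : arc_lift local_chart (rot_arc b) w.
    by case/orP: ab => /eqP e; move: wa; rewrite e ?arc_lift_flip.
  rewrite arc_lift_rot => -[x xb <-]; exists x => //; by exists b.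
move=> [x [b bt xb] <-].
have : arc_lift local_chart (rot_arc b) (rot_point x).
  by rewrite arc_lift_rot; exists x.
by case/orP: (allP (rot_arcs t) _ bt) => h ?;
  [exists (rot_arc b)|exists (flip_arc (rot_arc b))]; rewrite ?arc_lift_flip.
Qed.

Lemma segmentP (p q w : V) : segment p q w <-> exists t : R,
  [/\ 0 <= t, t <= 1 &
  w = (p.1.1 + t * (q.1.1 - p.1.1), p.1.2 + t * (q.1.2 - p.1.2),
       p.2 + t * (q.2 - p.2))].
Proof.
have E t : (1 - t) *: p + t *: q =
  (p.1.1 + t * (q.1.1 - p.1.1), p.1.2 + t * (q.1.2 - p.1.2),
       p.2 + t * (q.2 - p.2)).
  case: p q => [[a b] h] [[a' b'] h'].
  by congr (_, _, _) => /=; rewrite /GRing.scale /=; ring.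
split.
  move=> [t]; rewrite /= in_itv /= => /andP[t0 t1] <-.
  by exists t; split => //; exact: E.
by move=> [t [t0 t1 ->]]; exists t; [rewrite /= in_itv /= t0|exact: E].
Qed.

(** An over-strand stays below its distance to all four sides, and arcs with no
end on the left side stay in the right half of the square. *)
Lemma tile_points_bounds t (u v h : R) : tile_points t (u, v, h) ->
  [/\ 0 <= h, h <= u & h <= 1 - u] /\ [/\ h <= v, h <= 1 - v
   & ~~ connection t sideL -> 1 / 2 <= u].
Proof.
move=> [a]; have half : (2%:R / 2 : R) = 1 by field.
by case: t => //; rewrite ?inE; do ?[case/orP];
  move=> /eqP -> /= [] /segmentP[t [t0 t1 [-> -> ->]]] /=; split; split;
  rewrite ?(add0n, addn0, addn1, addnS) => //; try (move=> _); lra.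
Qed.

Lemma segment_half (p q : V) :
  segment p (1 / 2 *: p + 1 / 2 *: q) `|` segment (1 / 2 *: p + 1 / 2 *: q) q =
  segment p q.
Proof.
case: p q => [[a b] h] [[a' b'] h']; apply/seteqP; split=> w.
  case=> /segmentP[t [t0 t1 ->]]; apply/segmentP => /=; rewrite /GRing.scale /=.
    by exists (t / 2); split; [lra|lra|congr (_, _, _); field].
  by exists ((1 + t) / 2); split; [lra|lra|congr (_, _, _); field].
move=> /segmentP[t [t0 t1 ->]] /=; have [h2|h2] := leP t (1 / 2).
  left; apply/segmentP; exists (2 * t); rewrite /= /GRing.scale /=.
  by split; [lra|lra|congr (_, _, _); field].
right; apply/segmentP; exists (2 * t - 1); rewrite /= /GRing.scale /=.
by split; [lra|lra|congr (_, _, _); field].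
Qed.

Lemma arc_lift_chord (s t : side) : arc_lift local_chart (s, t, false) =
  segment ((side_mid2 s).1%:R / 2, (side_mid2 s).2%:R / 2, 0)
    ((side_mid2 t).1%:R / 2, (side_mid2 t).2%:R / 2, 0) :> set V.
Proof.
rewrite -segment_half /arc_lift; case: (side_mid2 s) => a b.
case: (side_mid2 t) => a' b'; rewrite /local_chart /=.
suff -> : ((a + a')%:R / 4, (b + b')%:R / 4, 0) =
   1 / 2 *: (a%:R / 2, b%:R / 2, 0) + 1 / 2 *: (a'%:R / 2, b'%:R / 2, 0) :> V by [].
by congr (_, _, _) => /=; rewrite /GRing.scale /= ?natrD; field.
Qed.

Lemma tile_points_arc t s s' : arcs t = [:: (s, s', false)] ->
  tile_points t = segment ((side_mid2 s).1%:R / 2, (side_mid2 s).2%:R / 2, 0)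
    ((side_mid2 s').1%:R / 2, (side_mid2 s').2%:R / 2, 0).
Proof.
move=> e; rewrite -arc_lift_chord; apply/seteqP; split=> w.
  by move=> [a]; rewrite e inE => /eqP ->.
by move=> h; exists (s, s', false) => //; rewrite e inE.
Qed.

Lemma tile_points_corner w : tile_points T2 w <->
  exists y : R, [/\ 0 <= y, y <= 1 / 2 & w = (1 / 2 + y, y, 0)].
Proof.
rewrite (@tile_points_arc T2 sideR sideD erefl) segmentP /=; split.
  move=> [t [t0 t1 ->]]; exists ((1 - t) / 2).
  by split; [lra|lra|congr (_, _, _); field].
move=> [y [y0 y1 ->]]; exists (1 - 2 * y).
by split; [lra|lra|congr (_, _, _); field].
Qed.

(** The slope, downwards, of the chord of a tile [T1] or [T5] from its left
side. *)
Definition chord_slope (t : tile) : R := if t is T1 then 1 else 0.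

Lemma tile_points_chord t w : t = T1 \/ t = T5 -> tile_points t w <->
  exists s : R, [/\ 0 <= s, s <= 1 - chord_slope t / 2
    & w = (s, 1 / 2 - chord_slope t * s, 0)].
Proof.
case=> -> /=.
  rewrite (@tile_points_arc T1 sideL sideD erefl) segmentP /=; split.
    move=> [t' [t0 t1 ->]]; exists (t' / 2).
    by split; [lra|lra|congr (_, _, _); field].
  move=> [y [y0 y1 ->]]; exists (2 * y).
  by split; [lra|lra|congr (_, _, _); field].
rewrite (@tile_points_arc T5 sideL sideR erefl) segmentP /=; split.
  move=> [t' [t0 t1 ->]]; exists t'.
  by split; [lra|lra|congr (_, _, _); field].
move=> [y [y0 y1 ->]]; exists y.
by split; [lra|lra|congr (_, _, _); field].
Qed.

End TilePoints.

(** * The fold carries the plane diagram to the cube *)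

Section Fold_mosaic.
Variables (R : realType) (n : nat) (M : 'I_n.+1 * 'I_n.+1 -> tile).
Notation V := (R * R * R)%type.
Variable c : 'I_n.+1 * 'I_n.+1.

Definition to_origin (p : V) : V :=
  slide (- c.1.+1%:R, - (c.2 : nat)%:R, 0) 1 p.
Definition to_cube_corner (p : V) : V := slide (0, n.+1%:R, n.+1%:R) 1 p.

Definition turn_point (f : face) (w : V) : V :=
  if f == faceY1 then rot_point w else w.

Lemma tile_points_turn f t :
  tile_points (R := R) (turn_tile f t) = turn_point f @` tile_points t.
Proof.
rewrite /turn_tile /turn_point; case: (f == faceY1).
  exact: tile_points_rot.
by rewrite image_id.
Qed.

Lemma plane_corner (q : 'I_n.+1 * 'I_n.+1) (u v h : R) :
  to_origin (on_chart (@plane_chart R _ q) (u, v, h)) =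
  ((q.1 : nat)%:R + u - c.1.+1%:R, (q.2 : nat)%:R + v - (c.2 : nat)%:R, h).
Proof. by rewrite /to_origin /slide /on_chart /=; congr (_, _, _); ring. Qed.

(** The hypothesis on the left side excludes only the square on the right of
the corner, where the fold does not respect local coordinates. *)
Lemma fold_glued (K x0 eps : R) q k (u v h : R) :
  2 * n.+1%:R + 1 <= K -> 0 <= eps <= 1 -> (K + eps) * x0 = 1 / 2 ->
  glued c q k -> tile_points (M q) (u, v, h) ->
  (q.1 = c.1.+1 :> nat -> (c.2 <= q.2)%N -> ~~ connection (M q) sideL) ->
  to_cube_corner (fold K x0 eps
    (to_origin (on_chart (@plane_chart R _ q) (u, v, h)))) =
  on_chart (cube_chart k) (turn_point k.1.1 (u, v, h)).
Proof.
move=> KN eps01 x0E qk wq noL.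
rewrite plane_corner /to_cube_corner.
set N : R := n.+1%:R in KN *; set X : R := c.1.+1%:R.
set Y : R := (c.2 : nat)%:R.
have N1 : 1 <= N by rewrite /N ler1n.
have K3 : 3 <= K by lra.
have [[h0 hu hu'] [hv hv' left_half]] := tile_points_bounds wq.
have nat_eq (a b : nat) : a = b -> a%:R = b%:R :> R by move=> ->.
have nat_le (a b : nat) : (a <= b)%N -> a%:R <= b%:R :> R by rewrite ler_nat.
have q1N : (q.1 : nat)%:R + 1 <= N by rewrite /N -natr1 lerD2r ler_nat -ltnS.
have q2N : (q.2 : nat)%:R + 1 <= N by rewrite /N -natr1 lerD2r ler_nat -ltnS.
have Y0 : 0 <= Y by exact: ler0n.
have X1 : 1 <= X by rewrite /X ler1n.
have XE : X = (c.1 : nat)%:R + 1 by rewrite /X -natr1.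
have NE : N = n%:R + 1 by rewrite /N -natr1.
have YE : Y = (c.2 : nat)%:R by [].
clearbody N X Y.
case: k qk => [[[] a] b] //= /and4P[].
- move=> /nat_le h1 /nat_le h2 /eqP/nat_eq h3 /eqP/nat_eq h4.
  move: h2 h3 h4; rewrite !natrD -!natr1 => h2 h3 h4.
  rewrite (fold_left_down K3 eps01 x0E); [|lra|lra|lra].
  by rewrite /slide /on_chart /turn_point /=; congr (_, _, _); lra.
- move=> lt1 le2 /eqP/nat_eq h3 /eqP e4.
  have h4 := nat_eq _ _ e4.
  have h1 := nat_le _ _ lt1; have h2 := nat_le _ _ le2.
  have xge : 1 / 2 <= (q.1 : nat)%:R + u - X.
    have [e|ne] := eqVneq (q.1 : nat) c.1.+1.
      have := left_half (noL e le2); have := nat_eq _ _ e.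
      by rewrite -(@natr1 _ c.1) => *; lra.
    have /nat_le : (c.1.+2 <= q.1)%N by rewrite ltn_neqAle eq_sym ne.
    by rewrite -(@natr1 _ c.1.+1) -(@natr1 _ c.1); lra.
  move: h3 h4; rewrite !natrD -!natr1 => h3 h4.
  rewrite (fold_right_up K3 eps01 x0E); [|lra|lra|lra|lra].
  by rewrite /slide /on_chart /turn_point /=; congr (_, _, _); lra.
- move=> /nat_le h1 /nat_le h2 /eqP/nat_eq h3 /eqP/nat_eq h4.
  move: h1 h2 h3 h4; rewrite !natrD -!natr1 => h1 h2 h3 h4.
  rewrite (fold_right_down K3 eps01 x0E); [|lra|lra|lra].
  by rewrite /slide /on_chart /turn_point /=; congr (_, _, _); lra.
Qed.

End Fold_mosaic.

(** Square by square. The chord on the right of the corner, cut at parameter x0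
in the plane and at x0 / 2 on the cube, is the only place where a point of the
cube diagram may come from another square, the corner. *)
Lemma tame_unfold (R : realType) (n : nat) (M : 'I_n.+1 * 'I_n.+1 -> tile)
    (c : 'I_n.+1 * 'I_n.+1) : knot_mosaic M -> corner M c ->
  exists2 F : R * R * R -> R * R * R, tame F &
    F @` mosaic_lift (@plane_chart R n.+1) M =
    mosaic_lift (@cube_chart R n.+1) (cube_mosaic M c).
Proof.
move=> hM hc.
have [r [r1 r2 rT]] := right_square hM hc.
pose N : R := n.+1%:R; pose X : R := c.1.+1%:R; pose Y : R := (c.2 : nat)%:R.
pose eps := chord_slope R (M r).
(* Every point of the upper right quadrant with x >= 1 / 2 is lowered fully, as
   K * x >= N. *)
pose K := 2 * N + 1.
(* The abscissa at which the chord of r is lowered fully. *)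
pose x0 := 1 / 2 / (K + eps).
have epsE : eps = 0 \/ eps = 1 by rewrite /eps; case: rT => -> ; [right|left].
have eps01 : 0 <= eps <= 1 by case: epsE => ->; rewrite lexx ler01.
have [eps0 eps1] := andP eps01.
have N1 : 1 <= N by rewrite /N ler1n.
have K3 : 3 <= K by rewrite /K; lra.
have Keps : 3 <= K + eps by lra.
have x0E : (K + eps) * x0 = 1 / 2.
  by rewrite /x0; field; rewrite gt_eqF//; lra.
have x0_gt0 : 0 < x0 by rewrite /x0 divr_gt0//; lra.
have x0_le : x0 <= 1 / 6.
  by rewrite /x0 ler_pdivrMr; lra.
pose F (p : R * R * R) := to_cube_corner n (fold K x0 eps (to_origin c p)).
exists F.
  apply: (tame_comp (translation_tame _)).
  exact: (tame_comp (fold_tame K3 eps01 x0E) (translation_tame _)).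
have rout : ~~ quadrant c r by rewrite /quadrant r1 ltnn.
have [k rk] := glued_exists rout.
have kf : k.1.1 = faceY1.
  by case: k rk => [[[] a] b] //= /and4P[]; rewrite ?r1 ?r2; lia.
have chordE s : on_chart (@plane_chart R _ r) (s, 1 / 2 - eps * s, 0) =
    (X + s, Y + (1 / 2 - eps * s), 0).
  by rewrite /on_chart /plane_chart /= r1 r2.
have faceE s :
    on_chart (cube_chart k) (turn_point k.1.1 (s, 1 / 2 - eps * s, 0)) =
    to_cube_corner n (s, 0, - (1 / 2) + eps * s).
  rewrite kf /turn_point /= ; case: k kf rk => [[f a] b] /= -> /and4P[_ _].
  rewrite r1 r2 => /eqP e1 /eqP e2.
  have b0 : (b : nat) = 0%N by lia.
  have an : (a : nat) = n by lia.
  rewrite /on_chart /to_cube_corner /slide /rot_point /= b0 an -natr1.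
  by congr (_, _, _); lra.
have after s : x0 <= s -> s <= 1 - eps / 2 ->
    F (on_chart (@plane_chart R _ r) (s, 1 / 2 - eps * s, 0)) =
    on_chart (cube_chart k) (turn_point k.1.1 (s, 1 / 2 - eps * s, 0)).
  move=> s0 s1; rewrite /F chordE faceE; congr to_cube_corner.
  rewrite -(fold_chord_after K3 eps01 x0E s0); last first.
    by case: epsE => e; rewrite e in s1 *; lra.
  by congr fold; rewrite /to_origin /slide /=; congr (_, _, _); ring.
have before s : 0 <= s -> s <= x0 ->
    F (on_chart (@plane_chart R _ r) (s, 1 / 2 - eps * s, 0)) =
    on_chart (cube_chart k)
      (turn_point k.1.1 ((x0 + s) / 2, 1 / 2 - eps * ((x0 + s) / 2), 0)).
  move=> s0 s1; rewrite /F chordE faceE; congr to_cube_corner.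
  rewrite -(fold_chord_before K3 eps01 x0E s0 s1).
  by congr fold; rewrite /to_origin /slide /=; congr (_, _, _); ring.
have at_corner y : 0 <= y -> y <= 1 / 2 ->
    F (on_chart (@plane_chart R _ c) (1 / 2 + y, y, 0)) =
    on_chart (cube_chart k)
      (turn_point k.1.1 (x0 * y, 1 / 2 - eps * (x0 * y), 0)).
  move=> y0 y1; rewrite /F faceE; congr to_cube_corner.
  rewrite -(fold_corner K3 eps01 x0E); last by rewrite y0.
  congr fold; rewrite /to_origin /slide /on_chart -natr1 /=.
  by congr (_, _, _); field.
have [cT top HD] := hc.
have cubeE q l w : glued c q l -> tile_points (M q) w ->
    tile_points (cube_mosaic M c l) (turn_point l.1.1 w).
  by move=> ql wq; rewrite (cube_mosaicE _ ql) tile_points_turn; exists w.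
have regular q l w : q <> r -> glued c q l -> tile_points (M q) w ->
    F (on_chart (@plane_chart R _ q) w) =
    on_chart (cube_chart l) (turn_point l.1.1 w).
  case: w => [[u v] h] qr ql wq.
  apply: (fold_glued (M := M) _ eps01 x0E ql wq); first exact: lexx.
  move=> q1 q2; apply: (above_right_no_left hM hc) => //.
  rewrite ltn_neqAle q2 andbT; apply/eqP => e; apply: qr.
  rewrite [q]surjective_pairing [r]surjective_pairing.
  by congr pair; apply/ord_inj; rewrite ?q1 ?r1// r2.
have chordP w := tile_points_chord (R := R) w rT.
rewrite !mosaic_liftE; [|exact: cube_chart_affine|exact: plane_chart_affine].
apply/seteqP; split=> p.
  move=> [_ [q [w [wq ->]]] <-].
  have [qD|qD] := boolP (quadrant c q).
    have qc : q = c.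
      by apply: HD => //; move: wq; case: (M q) => // -[].
    move: wq; rewrite qc cT => /tile_points_corner[y [y0 y1 ->]].
    rewrite at_corner//; exists k; eexists; split; last by [].
    apply: cubeE rk _; apply/chordP; exists (x0 * y); rewrite -/eps.
    split => //.
      by rewrite mulr_ge0// ltW.
    by nra.
  have [l ql] := glued_exists qD.
  have [qr|qr] := eqVneq q r; last first.
    rewrite (regular _ _ _ _ ql wq); last exact/eqP.
    by exists l; eexists; split; [exact: cubeE ql wq|].
  move: wq; rewrite {q ql qD}qr => /chordP[s [s0 s1 ->]]; rewrite -/eps in s1 *.
  have [sx|sx] := leP s x0.
    rewrite before//; exists k; eexists; split; last by [].
    apply: cubeE rk _; apply/chordP; exists ((x0 + s) / 2); rewrite -/eps.
    by split => //; lra.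
  rewrite after//; last exact: ltW.
  exists k; eexists; split; last by [].
  by apply: cubeE rk _; apply/chordP; exists s.
move=> [l [w [wl ->]]].
have [q ql] : exists q, glued c q l.
  apply: (@cube_mosaic_glued _ M).
  by move: wl; case: (cube_mosaic M c l) => // -[].
move: wl; rewrite (cube_mosaicE _ ql) tile_points_turn => -[w' wq <-].
have [qr|qr] := eqVneq q r; last first.
  exists (on_chart (@plane_chart R _ q) w'); first by exists q, w'.
  by apply: regular => //; exact/eqP.
rewrite qr in ql wq; have lk := glued_injr ql rk; rewrite lk {l ql lk}.
move: wq => /chordP[s [s0 s1 ->]]; rewrite -/eps in s1 *.
have [sx|/ltW sx] := leP x0 s.
  exists (on_chart (@plane_chart R _ r) (s, 1 / 2 - eps * s, 0));
    last exact: after.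
  by exists r; eexists; split; [|by []]; apply/chordP; exists s.
have [sx2|/ltW sx2] := leP (x0 / 2) s.
  exists (on_chart (@plane_chart R _ r)
    (2 * s - x0, 1 / 2 - eps * (2 * s - x0), 0)).
    exists r; eexists; split; last by [].
    by apply/chordP; exists (2 * s - x0); rewrite -/eps; split => //; lra.
  rewrite before; [|lra|lra].
  by rewrite (_ : (x0 + (2 * s - x0)) / 2 = s)//; field.
exists (on_chart (@plane_chart R _ c) (1 / 2 + s / x0, s / x0, 0)).
  exists c; eexists; split; last by [].
  rewrite cT; apply/tile_points_corner; exists (s / x0); split => //.
    by rewrite divr_ge0// ltW.
  by rewrite ler_pdivrMr//; lra.
rewrite at_corner.
- by rewrite (_ : x0 * (s / x0) = s)//; field; rewrite gt_eqF.
- by rewrite divr_ge0// ltW.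
- by rewrite ler_pdivrMr//; lra.
Qed.

Theorem theorem1p2 (R : realType) (K : set (R * R * R * R)%type) (hK : knot K) :
  (spherical_tiling_number K <= tiling_number K - 1%:E)%E.
Proof.
rewrite leeBrDr//; apply: le_ereal_inf_tmp => _ [k [n [M [n0 hM MK <-]]] <-].
case: n n0 M hM MK => // n _ M hM MK.
have [c hc] := exists_corner hM.
have [F Ft FE] := @tame_unfold R n M c hM hc.
have lt := cube_tile_count hc.
rewrite -leeBrDr// -EFinB.
apply: (@le_trans _ _ ((tile_count (cube_mosaic M c))%:R)%:E).
  apply: ereal_inf_lbound; exists (tile_count (cube_mosaic M c)) => //.
  exists n.+1, (cube_mosaic M c); split => //.
    exact: cube_spherical_knot_mosaic.
  apply: ambient_isotopic_trans MK; last by rewrite -FE; exact: Ft.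
  by move=> _ [p _ <-]; exact: to_sphere3_sphere.
by rewrite lee_fin lerBrDr natr1 ler_nat.
Qed.
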